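(* Let $T$ be a locally finite rooted tree with edge set $E$, $1<p<\infty$, $p^*=p/(p-1)$, $\pi:E\to(0,\infty)$ an edge weight and $\mu$ a positive Borel measure on $\overline{T}$. The Hardy operator $\mathcal{I}\varphi(x)=\sum_{\alpha\in[o^*,x]}\varphi(\alpha)$ is compact as a map $\mathcal{I}:\ell^p(\pi)\to L^p(\mu)$ if and only if $$\lim_{n\to\infty}\ \sup_{\alpha\in E,\ d(\alpha)\ge n}\ \frac{\sum_{\beta\subseteq\alpha}\pi(\beta)^{1-p^*}\mu(S(\beta))^{p^*}}{\mu(S(\alpha))}=0.$$
   Context: Tree setting. $T$ is a simple connected graph without cycles, with finite or countable vertex set, in which every vertex has finitely many neighbours; $E$ is its set of edges. A root vertex $o$ is fixed, together with an auxiliary pre-root vertex $o^*$ which is joined to $o$ (by the root edge $\omega\in E$) and to no other vertex. $T$ also denotes the set of vertices other than $o^*$. For vertices $x,y$, $[x,y]$ is the set of edges of the unique geodesic joining them. $\partial T$ is the set of maximal geodesics starting at $o^*$; if $T$ is infinite all of these are assumed infinite, and if $T$ is finite a maximal geodesic is identified with the leaf at which it ends. For $x\in\partial T$, $[o^*,x]$ is the set of edges of the geodesic $x$. Put $\overline{T}=T\cup\partial T$ and, for $\alpha\in E$, $S(\alpha)=\{x\in\overline{T}:\alpha\in[o^*,x]\}$. $\overline{T}$ carries the (compact) topology generated by the sets $S(\alpha)$, $\alpha\in E$, and the singletons $\{x\}$, $x\in T$; positive Borel measures on $\overline{T}$ are finite. For an edge $\beta$, $e(\beta)$ is its endpoint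 farthest from $o^*$, and for edges $\beta\subseteq\alpha$ means $\alpha\in[o^*,e(\beta)]$. $d(\alpha)$ is the distance between $\alpha$ and the root edge $\omega$ ($d(\omega)=0$, and $d$ increases by one from an edge to a child edge). $\ell^p(\pi)$ is the space of $\varphi:E\to\mathbb{R}$ with $\|\varphi\|_{\ell^p(\pi)}^p=\sum_\alpha|\varphi(\alpha)|^p\pi(\alpha)<\infty$, and $L^p(\mu)=L^p(\overline{T},\mu)$. Compactness of $\mathcal{I}$ includes its being well defined ($\mu$-a.e. absolutely convergent sums) and bounded. A quotient $0/0$ is interpreted as $0$, and the supremum of the empty set is $0$. *)

(* Defs.v *)
From HB Require Import structures.
From mathcomp Require Import all_boot all_order all_algebra finmap.
From mathcomp Require Import all_classical all_reals all_analysis.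

Set Implicit Arguments.
Unset Strict Implicit.
Unset Printing Implicit Defensive.

Import Order.TTheory GRing.Theory Num.Theory.
Import numFieldNormedType.Exports.

Local Open Scope classical_set_scope.
Local Open Scope ring_scope.

(* Vertex sequences follow path.v: the path x :: p starts at x, ends at
   last x p and has size p edges. *)
Record tree := Tree {
  vertex :> countType;
  adj : rel vertex;
  adj_sym : symmetric adj;
  adj_irr : irreflexive adj;
  adj_connected : forall x y, exists p, path adj x p /\ last x p = y;
  (* ucycle also holds of x :: y :: nil for adjacent x and y, which is not a
     cycle of a simple graph. *)
  adj_acyclic : forall c, ucycle adj c -> (size c <= 2)%N;
  adj_locally_finite : forall x, finite_set [set y | adj x y]
}.
Arguments adj {t} _ _.

Lemma connecting_path_length (T : tree) (x y : T) : exists n : nat,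
  `[< exists p, [/\ path adj x p, last x p = y & size p = n] >].
Proof.
have [p [xp py]] := adj_connected x y.
by exists (size p); apply/asboolP; exists p.
Qed.

Definition gdist (T : tree) (x y : T) : nat :=
  ex_minn (connecting_path_length x y).

Definition geodesic (T : tree) (x : T) (p : seq T) : Prop :=
  path adj x p /\ size p = gdist x (last x p).

(* The vertices include the pre-root. *)
Record rooted_tree := RootedTree {
  tree_of :> tree;
  root_vertex : tree_of;
  preroot : tree_of;
  preroot_adj : forall x, adj preroot x = (x == root_vertex);
  (* No finite geodesic issued from preroot is maximal when T is infinite. *)
  maximal_geodesics_infinite : infinite_set [set: tree_of] ->
    forall p, geodesic preroot p -> exists y, geodesic preroot (rcons p y)
}.
Arguments root_vertex {r}.
Arguments preroot {r}.

(* Edges are unordered pairs of adjacent vertices. *)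
Definition is_edge (T : tree) (A : {fset T}) : bool :=
  `[< exists x y, adj x y /\ A = [fset x; y]%fset >].

Definition edge (T : tree) : Type := {A : {fset T} | is_edge A}.
HB.instance Definition _ (T : tree) := Choice.on (edge T).

Lemma root_edge_subproof (T : rooted_tree) :
  is_edge [fset (preroot : T); root_vertex]%fset.
Proof. by apply/asboolP; exists preroot, root_vertex; rewrite preroot_adj eqxx. Qed.

Definition root_edge (T : rooted_tree) : edge T :=
  exist (fun A : {fset T} => is_edge A) _ (root_edge_subproof T).

Definition path_edges (T : tree) (x : T) (p : seq T) : set (edge T) :=
  [set a | exists2 i, (i < size p)%N &
    val a = [fset nth x (x :: p) i; nth x (x :: p) i.+1]%fset].

(* [x, y] *)
Definition geodesic_edges (T : tree) (x y : T) : set (edge T) :=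
  [set a | exists p, [/\ geodesic x p, last x p = y & path_edges x p a]].

(* The endpoint e(b) of b farthest from preroot; it is unique, since adjacent
   vertices of a tree are never equidistant from preroot. *)
Definition far_end (T : rooted_tree) (b : edge T) : T :=
  xget preroot [set x | x \in val b /\
    forall y, y \in val b -> (gdist preroot y <= gdist preroot x)%N].

Definition edge_sub (T : rooted_tree) (b a : edge T) : Prop :=
  geodesic_edges preroot (far_end b) a.

(* Distance between an edge and the root edge, measured between far ends, so
   that it is 0 at the root edge and grows by one from an edge to its child. *)
Definition edge_depth (T : rooted_tree) (a : edge T) : nat :=
  gdist (far_end (root_edge T)) (far_end a).

(* An infinite geodesic issued from preroot, as its sequence of vertices. *)
Definition is_ray (T : rooted_tree) (f : nat -> T) : bool :=
  `[< f 0%N = preroot /\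
      forall n, geodesic preroot (mkseq (fun i => f i.+1) n) >].

Definition ray (T : rooted_tree) : Type := {f : nat -> T | is_ray f}.
HB.instance Definition _ (T : rooted_tree) := Choice.on (ray T).

(* The compactification of T: vertices other than preroot (inl) and infinite
   geodesics (inr).  This covers all maximal geodesics: finite ones exist only
   when T is finite, and are then identified with the leaf where they end. *)
Definition tbar (T : rooted_tree) : Type :=
  ({x : T | x != preroot} + ray T)%type.
HB.instance Definition _ (T : rooted_tree) := Choice.on (tbar T).

Lemma root_neq_preroot (T : rooted_tree) : root_vertex != preroot :> T.
Proof.
apply/eqP => e; have := preroot_adj (root_vertex : T).
by rewrite -e adj_irr eqxx.
Qed.

HB.instance Definition _ (T : rooted_tree) :=
  isPointed.Build (tbar T)
    (inl (exist (fun x : T => x != preroot) _ (root_neq_preroot T))).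

(* [o*, x] for x in tbar T *)
Definition edges_to (T : rooted_tree) (x : tbar T) : set (edge T) :=
  match x with
  | inl v => geodesic_edges preroot (val v)
  | inr f => [set a | exists n, val a = [fset val f n; val f n.+1]%fset]
  end.

Definition S_ (T : rooted_tree) (a : edge T) : set (tbar T) :=
  [set x | edges_to x a].

Definition tbar_subbase (T : rooted_tree) : set (set (tbar T)) :=
  range (@S_ T) `|` range (fun v : {x : T | x != preroot} => [set inl v]).

HB.instance Definition _ (T : rooted_tree) :=
  isSubBaseTopological.Build (tbar T) (@tbar_subbase T) id.

Notation borel_tbar T := (g_sigma_algebraType (@open (tbar T))).

(* The p-th root of the sum defining the norm of ell^p(pi); +oo outside of
   ell^p(pi). *)
Definition lpi_norm (R : realType) (T : rooted_tree) (p : R)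
    (pi : edge T -> R) (phi : edge T -> R) : \bar R :=
  ((\esum_(a in [set: edge T]) (`|phi a| `^ p * pi a)%:E) `^ p^-1)%E.

Definition in_lpi (R : realType) (T : rooted_tree) (p : R)
    (pi : edge T -> R) (phi : edge T -> R) : Prop :=
  (\esum_(a in [set: edge T]) (`|phi a| `^ p * pi a)%:E < +oo)%E.

(* esum is a supremum of finite sums, so it computes a sum only for nonnegative
   terms: the absolutely convergent sum over [o*, x] is the difference of the
   sums of the positive and negative parts.  The value is meaningless where the
   sum does not converge absolutely. *)
Definition hardy (R : realType) (T : rooted_tree) (phi : edge T -> R)
    (x : borel_tbar T) : R :=
  fine ((\esum_(a in edges_to x) (EFin \o phi)^\+ a)
      - (\esum_(a in edges_to x) (EFin \o phi)^\- a))%E.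

Definition hardy_well_defined (R : realType) (T : rooted_tree) (p : R)
    (pi : edge T -> R) (mu : {measure set (borel_tbar T) -> \bar R}) : Prop :=
  forall phi, in_lpi p pi phi ->
    {ae mu, forall x, summable (edges_to x) (EFin \o phi)} /\
    (hardy phi : borel_tbar T -> R) \in Lfun mu p%:E.

Definition hardy_bounded (R : realType) (T : rooted_tree) (p : R)
    (pi : edge T -> R) (mu : {measure set (borel_tbar T) -> \bar R}) : Prop :=
  exists C : R, forall phi, in_lpi p pi phi ->
    ('N[mu]_p%:E [EFin \o hardy phi] <= C%:E * lpi_norm p pi phi)%E.

(* Bounded sequences of ell^p(pi) are mapped to sequences having a subsequence
   that converges in L^p(mu). *)
Definition hardy_compact (R : realType) (T : rooted_tree) (p : R)
    (pi : edge T -> R) (mu : {measure set (borel_tbar T) -> \bar R}) : Prop :=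
  [/\ hardy_well_defined p pi mu, hardy_bounded p pi mu &
    forall phi : nat -> edge T -> R,
      (forall k, in_lpi p pi (phi k)) ->
      (exists M : R, forall k, (lpi_norm p pi (phi k) <= M%:E)%E) ->
      exists s : nat -> nat, increasing_seq s /\
        exists2 g : borel_tbar T -> R, g \in Lfun mu p%:E &
          ('N[mu]_p%:E [EFin \o (hardy (phi (s k)) \- g)%R])%E @[k --> \oo]
            --> 0%E].

(* x / 0 is x * +oo in \bar R, so 0 / 0 = 0. *)
Definition mass_ratio (R : realType) (T : rooted_tree) (p : R)
    (pi : edge T -> R) (mu : {measure set (borel_tbar T) -> \bar R})
    (a : edge T) : \bar R :=
  let q := p / (p - 1) in
  ((\esum_(b in [set b | edge_sub b a]) ((pi b `^ (1 - q))%:E * mu (S_ b) `^ q))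
     / mu (S_ a))%E.

(* ereal_sup set0 is -oo: adding 0 makes the empty supremum 0 and does not
   change the others, the ratios being nonnegative. *)
Definition sup_mass_ratio (R : realType) (T : rooted_tree) (p : R)
    (pi : edge T -> R) (mu : {measure set (borel_tbar T) -> \bar R})
    (n : nat) : \bar R :=
  ereal_sup (0%E |`
    [set mass_ratio p pi mu a | a in [set a | (n <= edge_depth a)%N]]).

(* Main.v *)
Require Import Defs.
From HB Require Import structures.
From mathcomp Require Import all_boot all_order all_algebra finmap zify ring lra.
From mathcomp Require Import all_classical all_reals all_analysis measurable_realfun.

Set Implicit Arguments.
Unset Strict Implicit.
Unset Printing Implicit Defensive.

Import Order.TTheory GRing.Theory Num.Theory.
Import numFieldNormedType.Exports.

Local Open Scope classical_set_scope.
Local Open Scope ring_scope.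

(** Write [q] for the exponent conjugate to [p], [c b] for the weight
    [pi b ^ (1 - q) * mu (S_ b) ^ q], and [F x] for the sum of a nonnegative
    [phi] along the geodesic from the pre-root to [x].

    The limit condition implies compactness.  Let [g a] be the sum of [phi] over
    the edges above [a], [a] included, and let
    [D a = g a ^ p - (g a - phi a) ^ p] be the increment of the [p]-th power of
    the partial sums at [a].  Then [F x ^ p] telescopes into the sum of [D] along
    the geodesic of [x], and likewise [g a ^ p] is the sum of [D] over the edges
    above [a].  By Tonelli, the integral of [F ^ p] is the sum [X] of
    [D a * mu (S_ a)].  Convexity gives [D a <= p * phi a * g a ^ (p - 1)], and
    Young's inequality splits [p * phi a * g a ^ (p - 1) * mu (S_ a)] into a
    large multiple of [phi a ^ p * pi a] and a small multiple of [g a ^ p * c a].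
    When the sum of [c] over the edges below [b] is at most [K * mu (S_ b)],
    exchanging the order of summation bounds the sum of [g a ^ p * c a] by
    [K * X]; a suitable parameter in Young's inequality makes this contribution
    [X / 2], so that [X] is at most a constant times the energy of [phi]
    ([truncated_energy]), and this constant tends to [0] with [K].

    The estimate applied to the part of [phi] at depth at least [n] only uses the
    condition on [K] at depth at least [n], whereas the part at smaller depth
    lives on finitely many edges, since the tree is locally finite.  This proves
    boundedness ([hardy_bounded_of_carleson]).  For compactness, a bounded
    sequence in [ell^p(pi)] converges at every edge along an ultrafilter, to a
    function of finite energy.  The images converge in [L^p(mu)] along the same
    ultrafilter, the tails being uniformly small, and a convergent subsequence
    can be extracted ([hardy_compact_of_limit]).

    Conversely, let the operator be compact.  For a set [B] of edges below [a]
    with [N := \sum_(b in B) c b] finite, the multiple of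
    [pi ^ (1 - q) * mu (S_ _) ^ (q - 1)] on [B] that has norm [1] is mapped to a
    function supported in [S_ a] with integral [N ^ q^-1].  Hoelder's inequality
    then gives [N <= norm ^ q * mu (S_ a)], [norm] being the [L^p] norm of the
    image ([test_function_bound]).  So the sum of [c] over all edges is finite
    and its tails vanish.  If the ratio did not tend to [0], test functions for
    deeper and deeper edges would have images with norm bounded below but
    integral tending to [0]; the limit of a subsequence would vanish almost
    everywhere, which is absurd ([limit_of_hardy_compact]).

    Both parts use little of the geometry of the tree: the edges of a geodesic
    issued from the pre-root are determined by their depth, and those above a
    given edge of the geodesic are exactly those of smaller or equal depth
    ([edge_sub_edges_to], [edge_depth_inj]).  This follows from the fact that no
    path joins the ends of an edge without using it ([adj_bridge]). *)

(** * Distances in a tree *)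

Section TreeDistance.
Context (T : tree).
Implicit Types x y z u v : T.

Lemma gdist_path x p : path adj x p -> (gdist x (last x p) <= size p)%N.
Proof.
move=> xp; rewrite /gdist; case: ex_minnP => m _; apply.
by apply/asboolP; exists p.
Qed.

Lemma geodesic_ex x y : exists2 p, geodesic x p & last x p = y.
Proof.
have : exists2 p, path adj x p /\ last x p = y & size p = gdist x y.
  by rewrite /gdist; case: ex_minnP => m /asboolP[p [xp py pm]] _; exists p.
by move=> [p [xp py] pd]; exists p => //; split=> //; rewrite py.
Qed.

Lemma gdist_adj x y z : adj y z -> (gdist x z <= (gdist x y).+1)%N.
Proof.
move=> yz; have [p [xp sp] py] := geodesic_ex x y.
have : path adj x (rcons p z) by rewrite rcons_path xp py.
by move/gdist_path; rewrite last_rcons size_rcons sp py.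
Qed.

Lemma gdist_id x : gdist x x = 0%N.
Proof. by apply/eqP; rewrite -leqn0; exact: (@gdist_path x [::]). Qed.

Lemma gdist_eq0 x y : gdist x y = 0%N -> y = x.
Proof. by have [p [_ sp] <-] := geodesic_ex x y; rewrite -sp => /size0nil->. Qed.

(** Adjacency in the graph deprived of the edge between [x] and [y]. *)
Definition avoid x y : rel T :=
  fun u v => adj u v && ~~ ((u == x) && (v == y) || (u == y) && (v == x)).

Lemma avoid_sym x y : symmetric (avoid x y).
Proof. by move=> u v; rewrite /avoid adj_sym orbC andbC ![(v == _) && _]andbC andbC. Qed.

(** Removing the loops of such a path leaves a simple one, which the edge from [y]
    to [x] closes into a cycle of length at least [3]. *)
Lemma adj_bridge x y p : adj x y -> path (avoid x y) x p -> last x p != y.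
Proof.
move=> xy /shortenP[p' xp' up' _]; apply/eqP => py.
have xap' : path adj x p' by apply: sub_path xp' => u v /andP[].
have : ucycle adj (x :: p').
  by apply/andP; split => //=; rewrite rcons_path xap' py adj_sym.
move/adj_acyclic; case: p' py xp' {xap' up'} => [/=|z [|//]].
  by move=> yx; move: xy; rewrite yx adj_irr.
by move=> /= -> /andP[/andP[_]]; rewrite !eqxx.
Qed.

(** Adjacency oriented away from [o]. *)
Definition outward (o : T) : rel T :=
  fun u v => adj u v && (gdist o v == (gdist o u).+1).

(** A path is geodesic as soon as each of its steps increases the distance to
    its origin; this makes geodesics local objects. *)
Lemma geodesicP o p : geodesic o p <-> path (outward o) o p.
Proof.
elim/last_ind: p => [|p z IH]; first by split=> // _; split; rewrite //= gdist_id.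
split.
- move=> [+ +]; rewrite rcons_path last_rcons size_rcons => /andP[op pz] sp.
  have le1 := gdist_adj o pz; have le2 := gdist_path op.
  have e : size p = gdist o (last o p).
    by apply/eqP; rewrite eqn_leq le2 andbT -ltnS sp.
  by rewrite rcons_path /outward pz -sp e eqxx !andbT; apply/IH.
- rewrite rcons_path => /andP[/IH[op sp]] /andP[pz /eqP e].
  by split; rewrite ?rcons_path ?op// size_rcons last_rcons sp e.
Qed.

Lemma geodesic_below o p : geodesic o p ->
  path (fun u v => outward o u v && (gdist o v <= gdist o (last o p))%N) o p.
Proof.
move/geodesicP; elim/last_ind: p => [//|p z IH].
rewrite !rcons_path !last_rcons leqnn andbT => /andP[/IH op pz].
rewrite pz andbT; apply: sub_path op => u v /andP[-> /=] /leq_trans; apply.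
by case/andP: pz => _ /eqP->.
Qed.

Lemma geodesic_avoid o p x y : geodesic o p ->
  (gdist o (last o p) < maxn (gdist o x) (gdist o y))%N \/
    gdist o x = gdist o y ->
  path (avoid x y) o p.
Proof.
move=> gp H; apply: sub_path (geodesic_below gp) => u v /andP[/andP[uv /eqP e] l].
rewrite /avoid uv/=; apply/negP => /orP[] /andP[/eqP ? /eqP ?]; subst u v.
- case: H => [|H]; last by move: e; rewrite H; elim: (gdist o y) => // n IH [].
  by rewrite e (maxn_idPr _)// -e ltnNge l.
- case: H => [|H]; last by move: e; rewrite H; elim: (gdist o y) => // n IH [].
  by rewrite e (maxn_idPl _)// -e ltnNge l.
Qed.

(** Two descents to [o], from [x] and from [y], make a path from [x] to [y];
    an edge from [x] to [y] which neither of them uses would close a cycle. *)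
Lemma no_shortcut o x y p q : adj x y -> path (avoid x y) o p ->
  path (avoid x y) o q -> last o p = x -> last o q = y -> False.
Proof.
move=> xy op oq px qy.
have lx : last x (rev (belast o p)) = o.
  by case: (p) px => [//|a s] _; rewrite /= rev_cons last_rcons.
have : path (avoid x y) x (rev (belast o p) ++ q).
  rewrite cat_path lx oq andbT -px rev_path; apply: sub_path op => u v.
  by rewrite px avoid_sym.
by move/(adj_bridge xy); rewrite last_cat lx qy eqxx.
Qed.

(** Adjacent vertices at the same distance from [o] would be joined through [o]
    by two geodesics, neither of which uses the edge between them. *)
Lemma adj_outward o x y : adj x y -> outward o x y \/ outward o y x.
Proof.
move=> xy; have yx : adj y x by rewrite adj_sym.
rewrite /outward xy yx/=; have l1 := gdist_adj o xy; have l2 := gdist_adj o yx.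
have [xy_lt|yx_lt|e] := ltngtP (gdist o x) (gdist o y).
- by left; rewrite eqn_leq l1 xy_lt.
- by right; rewrite eqn_leq l2 yx_lt.
exfalso; have [p gp px] := geodesic_ex o x; have [q gq qy] := geodesic_ex o y.
by apply: (no_shortcut xy) px qy; apply: geodesic_avoid => //; right.
Qed.

(** Uniqueness of the parent: with two parents [x] and [y] of [z], one could go
    from [x] up to [o], down to [y] and then to [z] without the edge from [x] to
    [z]. *)
Lemma outward_inj o x y z : outward o x z -> outward o y z -> x = y.
Proof.
move=> /andP[xz /eqP dx] /andP[yz /eqP dy]; apply/eqP/negPn/negP => xy.
have [p gp px] := geodesic_ex o x; have [q gq qy] := geodesic_ex o y.
apply: (@no_shortcut o x z p (rcons q z)) => //; last by rewrite last_rcons.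
  by apply: geodesic_avoid => //; left; rewrite px dx leq_max ltnSn orbT.
rewrite rcons_path; apply/andP; split.
  by apply: geodesic_avoid => //; left; rewrite qy dy leq_max ltnSn orbT.
rewrite qy /avoid yz/= eqxx andbT; apply/negP => /orP[/eqP e|/andP[/eqP e _]].
  by rewrite e eqxx in xy.
by rewrite e adj_irr in yz.
Qed.

Lemma finite_ball o n : finite_set [set x : T | (gdist o x <= n)%N].
Proof.
elim: n => [|n IH].
  apply: (@sub_finite_set _ _ [set o]) => [x /=|]; last exact: finite_set1.
  by rewrite leqn0 => /eqP/gdist_eq0.
apply: (@sub_finite_set _ _ ([set x : T | (gdist o x <= n)%N] `|`
  \bigcup_(y in [set x : T | (gdist o x <= n)%N]) [set x : T | adj y x])); last first.
  rewrite finite_setU; split => //; apply: bigcup_finite => // y _.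
  exact: adj_locally_finite.
move=> x /=; rewrite leq_eqVlt ltnS => /orP[/eqP dx|]; last by left.
right; have [p [op sp] px] := geodesic_ex o x.
case/lastP: p => [|p z] in op sp px *; first by move: dx; rewrite -px gdist_id.
move: px op sp; rewrite rcons_path !last_rcons size_rcons => -> /andP[op pz] sp.
exists (last o p) => //=; apply: leq_trans (gdist_path op) _.
by rewrite -ltnS sp dx.
Qed.

End TreeDistance.
(** * Edges of a rooted tree and their order *)

Section RootedTree.
Context (T : rooted_tree).
Implicit Types (u v w : T) (a b c : edge T).
Local Notation o := (preroot : T).
Local Notation up := (outward (preroot : T)).

Definition parent v : T := xget o [set u | up u v].

Lemma up_parent u v : up u v -> parent v = u.
Proof.
move=> uv; have pv : up (parent v) v.
  exact: (@xgetPex _ o [set u | up u v] (ex_intro _ u uv)).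
exact: outward_inj pv uv.
Qed.

Lemma parent_up v : v != o -> up (parent v) v.
Proof.
move=> vo; have [p gp pv] := geodesic_ex o v.
case/lastP: p gp pv => [_ /esym/eqP|p z /geodesicP]; first by rewrite (negPf vo).
rewrite rcons_path last_rcons => /andP[_ pz] <-.
by rewrite (up_parent pz).
Qed.

Lemma gdist_parent v : v != o -> gdist o v = (gdist o (parent v)).+1.
Proof. by move=> /parent_up/andP[_ /eqP]. Qed.

Lemma gdist_iter_parent i v : (i <= gdist o v)%N ->
  gdist o (iter i parent v) = (gdist o v - i)%N.
Proof.
elim: i => [|i IH] iv; first by rewrite subn0.
have d := IH (ltnW iv); have : iter i parent v != o.
  by apply/eqP => e; move: d iv; rewrite e gdist_id -subn_gt0 => <-.
by move/gdist_parent; rewrite d /= subnS => ->.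
Qed.

(** Read from its end, the geodesic to a vertex lists the successive parents of
    this vertex; in particular it is unique. *)
Lemma geodesic_nth p k : geodesic o p -> (k <= size p)%N ->
  nth o (o :: p) (size p - k) = iter k parent (last o p).
Proof.
move=> /geodesicP/(pathP o) gp; elim: k => [|k IH] kp.
  by rewrite subn0 nth_last.
have lt : (size p - k.+1 < size p)%N by rewrite subnSK ?leq_subr.
have := up_parent (gp _ lt).
by rewrite -[nth _ p _]/(nth o (o :: p) _.+1) subnSK// (IH (ltnW kp)) => <-.
Qed.

Lemma far_end_up a u v : val a = [fset u; v]%fset -> up u v -> far_end a = v.
Proof.
move=> auv uv; have dv : gdist o v = (gdist o u).+1 by case/andP: uv => _ /eqP.
rewrite /far_end; case: xgetP => [w _ [wa /(_ v)]|/(_ v) []].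
  rewrite auv !inE eqxx orbT dv => /(_ isT); move: wa; rewrite auv !inE.
  by case/orP=> /eqP -> //; rewrite ltnn.
split; first by rewrite auv !inE eqxx orbT.
by move=> y; rewrite auv !inE => /orP[] /eqP ->//; rewrite dv.
Qed.

(** An edge is the pair formed by its far end and the parent of its far end, so
    that edges correspond to the vertices other than the pre-root. *)
Lemma edgeE a : up (parent (far_end a)) (far_end a) /\
  val a = [fset parent (far_end a); far_end a]%fset.
Proof.
have /asboolP[x [y [xy axy]]] := valP a.
wlog H : x y xy axy / up x y.
  move=> wl; have [H|H] := adj_outward o xy; first exact: wl H.
  by apply: wl H; rewrite 1?adj_sym// axy fsetUC.
by rewrite (far_end_up axy H) (up_parent H).
Qed.

Lemma far_end_neq a : far_end a != o.
Proof.
have [/andP[_ /eqP e] _] := edgeE a.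
by apply/eqP => E; move: e; rewrite {1}E gdist_id.
Qed.

Lemma far_end_inj : injective (@far_end T).
Proof.
move=> a b ab; apply: val_inj.
by have [_ ->] := edgeE a; have [_ ->] := edgeE b; rewrite ab.
Qed.

Lemma gdist_root : gdist o root_vertex = 1%N.
Proof.
apply/eqP; rewrite eqn_leq; apply/andP; split.
  by apply: (@gdist_path _ o [:: root_vertex]); rewrite /= preroot_adj eqxx.
rewrite lt0n; apply/eqP => /gdist_eq0 /eqP.
by rewrite (negPf (root_neq_preroot T)).
Qed.

Lemma edge_depthE a : edge_depth a = (gdist o (far_end a)).-1.
Proof.
have or : adj o root_vertex by rewrite preroot_adj.
rewrite /edge_depth (@far_end_up _ o root_vertex)//; last first.
  by rewrite /outward or gdist_root gdist_id.
apply/eqP; rewrite eqn_leq; apply/andP; split.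
- have [p [op sp] pv] := geodesic_ex o (far_end a).
  case: p op sp pv => [|z p] op sp pv.
    by move: (far_end_neq a); rewrite -pv eqxx.
  move: op; rewrite /= preroot_adj => /andP[/eqP ez zp].
  rewrite ez /= in zp sp pv; rewrite pv in sp.
  by move: (gdist_path zp); rewrite pv -sp.
- have [p [op sp] pv] := geodesic_ex root_vertex (far_end a).
  have : path adj o (root_vertex :: p) by rewrite /= or.
  by move/gdist_path; rewrite /= pv sp pv; case: (gdist o _).
Qed.

Lemma gdist_far_end a : gdist o (far_end a) = (edge_depth a).+1.
Proof. by rewrite edge_depthE prednK// gdist_parent ?far_end_neq. Qed.

Lemma finite_depth n : finite_set [set a : edge T | (edge_depth a < n)%N].
Proof.
apply: (@sub_finite_set _ _ (@far_end T @^-1` [set v : T | (gdist o v <= n)%N])).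
  by move=> a /=; rewrite gdist_far_end.
by apply: finite_preimage (finite_ball _ _); move=> a b _ _; exact: far_end_inj.
Qed.

Lemma edges_to_vertexE v a : geodesic_edges o v a <->
  exists2 i, (i < gdist o v)%N & far_end a = iter i parent v.
Proof.
split.
- move=> [p [gp pv [i ip ae]]]; have up_i := (pathP o (iffLR (geodesicP o p) gp)) i ip.
  have sp : size p = gdist o v by case: gp => _; rewrite pv.
  exists (size p - i.+1)%N; first by rewrite -sp -subSn// subSS leq_subr.
  rewrite (far_end_up ae up_i) -pv -geodesic_nth ?leq_subr//.
  by rewrite subKn.
- move=> [i iv ai]; have [p gp pv] := geodesic_ex o v.
  have sp : size p = gdist o v by case: gp => _; rewrite pv.
  have ip : (i < size p)%N by rewrite sp.
  exists p; split => //; exists (size p - i.+1)%N.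
    by rewrite -subSn// subSS leq_subr.
  have [_ ->] := edgeE a.
  rewrite ai -iterS -pv -!geodesic_nth ?(ltnW ip)//.
  by rewrite -[in RHS]subSn // subSS.
Qed.

Lemma ray_up (f : ray T) n : up (val f n) (val f n.+1).
Proof.
have /asboolP[f0 gf] := valP f.
have /geodesicP/(pathP o)/(_ n) := gf n.+1.
rewrite size_mkseq => /(_ (ltnSn _)); rewrite nth_mkseq//.
by case: n => [|n]; rewrite /= ?f0// nth_mkseq.
Qed.

Lemma ray_gdist (f : ray T) n : gdist o (val f n) = n.
Proof.
elim: n => [|n IH]; first by have /asboolP[-> _] := valP f; rewrite gdist_id.
by have /andP[_ /eqP->] := ray_up f n; rewrite IH.
Qed.

Lemma ray_iter (f : ray T) n i : iter i parent (val f (i + n)%N) = val f n.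
Proof.
elim: i n => [//|i IH] n; rewrite iterS addSnnS IH.
exact: up_parent (ray_up f n).
Qed.

Lemma edges_to_rayE (f : ray T) a :
  edges_to (inr f : tbar T) a <-> exists n, far_end a = val f n.+1.
Proof.
split=> -[n e]; exists n; first exact: far_end_up e (ray_up f n).
by have [_ ->] := edgeE a; rewrite e (up_parent (ray_up f n)).
Qed.

Lemma edge_sub_refl a : edge_sub a a.
Proof. by apply/edges_to_vertexE; exists 0%N; rewrite ?gdist_far_end. Qed.

(** The geodesic of a point is a chain of edges ordered by depth, and the edges
    above one of its members are an initial segment of it.  With
    [edge_depth_inj], this is all that the estimates use of the tree order. *)
Lemma edge_sub_edges_to (x : tbar T) a b : edges_to x a ->
  edge_sub a b <-> edges_to x b /\ (edge_depth b <= edge_depth a)%N.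
Proof.
case: x => [[v vo]|f].
- rewrite /= => /edges_to_vertexE[i iv ai].
  have da := gdist_iter_parent (ltnW iv); rewrite -ai gdist_far_end in da.
  split.
  + move=> /edges_to_vertexE[j]; rewrite gdist_far_end ai -iterD => ja bj.
    have db := @gdist_iter_parent (j + i) v.
    rewrite -bj gdist_far_end in db.
    split; last by lia.
    by apply/edges_to_vertexE; exists (j + i)%N => //; lia.
  + move=> [/edges_to_vertexE[j jv bj] dba].
    have db := gdist_iter_parent (ltnW jv); rewrite -bj gdist_far_end in db.
    apply/edges_to_vertexE; exists (j - i)%N; first by rewrite gdist_far_end; lia.
    by rewrite ai -iterD bj; congr iter; lia.
- move=> /edges_to_rayE[n an].
  have da : edge_depth a = n by apply: succn_inj; rewrite -gdist_far_end an ray_gdist.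
  split.
  + move=> /edges_to_vertexE[j]; rewrite gdist_far_end da an => jn bj.
    have e : far_end b = val f (n - j).+1.
      by rewrite bj -(ray_iter f (n - j).+1 j); congr (iter _ _ (val f _)); lia.
    split; first by apply/edges_to_rayE; exists (n - j)%N.
    by have := gdist_far_end b; rewrite e ray_gdist; lia.
  + move=> [/edges_to_rayE[m bm]]; have db : edge_depth b = m.
      by apply: succn_inj; rewrite -gdist_far_end bm ray_gdist.
    rewrite da db => mn; apply/edges_to_vertexE; exists (n - m)%N.
      by rewrite gdist_far_end da; lia.
    by rewrite an bm -(ray_iter f m.+1 (n - m)); congr (iter _ _ (val f _)); lia.
Qed.

Lemma edge_sub_depth a b : edge_sub a b -> (edge_depth b <= edge_depth a)%N.
Proof.
pose x : tbar T := inl (exist _ (far_end a) (far_end_neq a)).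
have xa : edges_to x a by exact: edge_sub_refl.
by move=> /(edge_sub_edges_to b xa)[].
Qed.

Lemma edge_depth_inj (x : tbar T) a b : edges_to x a -> edges_to x b ->
  edge_depth a = edge_depth b -> a = b.
Proof.
move=> xa xb ab; apply: far_end_inj; move: xa xb.
have e : gdist o (far_end a) = gdist o (far_end b) by rewrite !gdist_far_end ab.
case: x => [[v vo]|f].
- move=> /edges_to_vertexE[i iv ai] /edges_to_vertexE[j jv bj].
  have da := gdist_iter_parent (ltnW iv); have db := gdist_iter_parent (ltnW jv).
  rewrite -ai e in da; rewrite -bj da in db; rewrite ai bj; congr iter; lia.
- move=> /edges_to_rayE[n an] /edges_to_rayE[m bm].
  by move: e; rewrite an bm !ray_gdist => ->.
Qed.

End RootedTree.
(** * Sums of nonnegative families *)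

Section Esum.
Context (R : realType) (I : choiceType).
Implicit Types (A : set I) (f : I -> \bar R) (d : I -> nat).

Lemma esumZl A f (k : R) : 0 <= k -> (forall i, 0 <= f i)%E ->
  (\esum_(i in A) (k%:E * f i) = k%:E * \esum_(i in A) f i)%E.
Proof.
move=> k0 f0; rewrite /esum -ereal_supZl//; last first.
  by apply/set0P; exists (\sum_(i \in set0) f i)%E; exists set0 => //; exact: fsets_set0.
rewrite image_comp; congr ereal_sup; apply: eq_imagel => X _ /=.
by rewrite ge0_mule_fsumr.
Qed.

(** A sum is the supremum of its parts where an index [d] is bounded: a finite
    set of summands only meets finitely many values of [d]. *)
Lemma esum_le_bounded d A f (M : \bar R) : (forall i, 0 <= f i)%E ->
  (forall n, \esum_(i in A `&` [set i | (d i < n)%N]) f i <= M)%E ->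
  (\esum_(i in A) f i <= M)%E.
Proof.
move=> f0 le_M; apply: ge_ereal_sup => _ [X [finX XA] <-].
apply: le_trans (le_M (\max_(i <- fset_set X) d i).+1); apply: esum_ge.
exists X => //; split=> // i Xi; split; first exact: XA.
rewrite /= ltnS; apply: (leq_bigmax_seq (P := predT) (F := d)) => //.
by rewrite in_fset_set// inE.
Qed.

Lemma esum_subset A B f : A `<=` B -> (\esum_(i in A) f i <= \esum_(i in B) f i)%E.
Proof.
move=> AB; apply: ge_ereal_sup => _ [X [finX XA] <-].
by apply: esum_ge; exists X => //; split=> // i /XA /AB.
Qed.

(** Were all the tails at least [e], every part with bounded index would be at
    most the sum minus [e], hence so would the sum. *)
Lemma esum_tail d A f : (forall i, 0 <= f i)%E -> (\esum_(i in A) f i < +oo)%E ->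
  forall e : R, 0 < e -> exists n,
    (\esum_(i in A `&` [set i | (n <= d i)%N]) f i <= e%:E)%E.
Proof.
move=> f0 Afin e e0; apply: contrapT => /forallNP H.
set s := (\esum_(i in A) f i)%E in Afin.
have s0 : (0 <= s)%E by exact: esum_ge0.
have sfin : s \is a fin_num by rewrite ge0_fin_numE.
suff : (s <= s - e%:E)%E.
  by rewrite leeBrDr// -[leRHS]adde0 leeD2lE// lee_fin leNgt e0.
apply: (@esum_le_bounded d) => // n; rewrite leeBrDr//.
rewrite /s (esumID [set i | (d i < n)%N] A f)//.
apply: leeD2l; rewrite ltW// ltNge; apply/negP => le_e; apply: (H n).
apply: le_trans le_e; apply: esum_subset => i /= [Ai dn]; split=> //=.
by apply/negP; rewrite -leqNgt.
Qed.

End Esum.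

Section EsumMore.
Context (R : realType).

Lemma esum_EFin_fin_num (I : choiceType) (A : set I) (f : I -> R) :
  finite_set A -> (forall i, 0 <= f i) ->
  (\esum_(i in A) (f i)%:E)%E \is a fin_num.
Proof.
move=> finA f0; rewrite esum_fset//; last by move=> i _; rewrite lee_fin.
by rewrite fsbig_finite//= sumEFin.
Qed.

Lemma esum_exchange (I J : choiceType) (A : set I) (B : I -> set J)
    (C : set J) (D : J -> set I) (f : I -> J -> \bar R) :
  (forall i j, 0 <= f i j)%E ->
  (forall i j, A i /\ B i j <-> C j /\ D j i) ->
  (\esum_(i in A) \esum_(j in B i) f i j = \esum_(j in C) \esum_(i in D j) f i j)%E.
Proof.
move=> f0 ABCD; rewrite !esum_esum//.
rewrite (reindex_esum (C `*`` D) (A `*`` B) (fun k : J * I => (k.2, k.1)))//.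
split.
- by move=> [j i] /= ?; apply/ABCD.
- by move=> [j i] [j' i'] _ _ /= [-> ->].
- by move=> [i j] /ABCD ?; exists (j, i).
Qed.

End EsumMore.

(** * Integration of sums along geodesics *)

Section Borel.
Context (R : realType) (T : rooted_tree).
Implicit Types (a : edge T) (f : edge T -> \bar R).

Lemma open_S a : open (S_ a : set (tbar T)).
Proof.
exists [set (S_ a : set (tbar T))]; last by rewrite bigcup_set1.
move=> _ ->; exists [fset (S_ a : set (tbar T))]%fset.
  by move=> i; rewrite in_fset1 => /eqP ->; rewrite inE; left; exists a.
by apply/seteqP; split=> x /=; [apply; rewrite /= inE|move=> Sx i; rewrite /= inE => /eqP ->].
Qed.

Lemma measurable_S a : measurable (S_ a : set (borel_tbar T)).
Proof. by apply: sub_sigma_algebra; exact: open_S. Qed.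

(** Singletons or empty sets that cover the edges: a sum over edges becomes a
    series, to which countable additivity applies. *)
Definition edges_coded (n : nat) : set (edge T) :=
  [set a : edge T | choice.pickle (far_end a : T) = n].

Lemma edges_codedP n :
  edges_coded n = set0 \/ exists a, edges_coded n = [set a].
Proof.
have [->|/set0P[a an]] := eqVneq (edges_coded n) set0; [by left|right].
exists a; apply/seteqP; split=> [b bn|_ -> //].
by apply/far_end_inj/(pcan_inj choice.pickleK); rewrite bn.
Qed.

Lemma esum_coded f : (forall a, 0 <= f a)%E ->
  (\esum_(a in [set: edge T]) f a = \sum_(0 <= n <oo) \esum_(a in edges_coded n) f a)%E.
Proof.
move=> f0; rewrite -nneseries_sum_bigcup//.
  by congr esum; apply/esym/seteqP; split => // a _; exists (choice.pickle (far_end a : T)).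
by move=> i j _ _ [a [<- <-]].
Qed.

Lemma esum_edges_to f (x : borel_tbar T) :
  (\esum_(a in edges_to (x : tbar T)) f a =
   \esum_(a in [set: edge T]) (f a * (\1_(S_ a) x)%:E))%E.
Proof.
rewrite esum_mkcond; apply: eq_esum => a _; rewrite indicE.
rewrite (_ : (x \in S_ a) = (a \in edges_to (x : tbar T))) ?mem_setE//.
by case: ifP => _; rewrite ?mule1 ?mule0.
Qed.

Lemma measurable_esum_coded f n : (forall a, 0 <= f a)%E ->
  measurable_fun [set: borel_tbar T]
    ((fun x => \esum_(a in edges_coded n) (f a * (\1_(S_ a) x)%:E)%E) :
      borel_tbar T -> \bar R).
Proof.
move=> f0; have [->|[a ->]] := edges_codedP n.
  by under eq_fun do rewrite esum_set0; exact: measurable_cst.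
under eq_fun do rewrite esum_set1 ?mule_ge0// ?lee_fin//.
apply: emeasurable_funM => //; apply/measurable_EFinP.
by apply: measurable_indic; exact: measurable_S.
Qed.

Lemma measurable_esum_edges_to f : (forall a, 0 <= f a)%E ->
  measurable_fun [set: borel_tbar T]
    ((fun x => \esum_(a in edges_to (x : tbar T)) f a) :
      borel_tbar T -> \bar R).
Proof.
move=> f0; under eq_fun => x.
  rewrite esum_edges_to esum_coded; last by move=> a; rewrite mule_ge0// lee_fin.
  over.
apply: (ge0_emeasurable_sum (P := predT)) => [n x _ _|n _]; last exact: measurable_esum_coded.
by apply: esum_ge0 => a _; rewrite mule_ge0// lee_fin.
Qed.

(** Tonelli: an edge [a] contributes to the sum at [x] exactly when [x] is in
    [S_ a]. *)
Lemma integral_esum_edges_to (mu : {measure set (borel_tbar T) -> \bar R}) f :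
  (forall a, 0 <= f a)%E ->
  (\int[mu]_x (\esum_(a in edges_to (x : tbar T)) f a) =
   \esum_(a in [set: edge T]) (f a * mu (S_ a)))%E.
Proof.
move=> f0; have g0 a x : (0 <= f a * (\1_(S_ a) x : R)%:E)%E.
  by rewrite mule_ge0// lee_fin.
under eq_integral do rewrite esum_edges_to esum_coded//.
rewrite integral_nneseries//; last 2 first.
- by move=> n; exact: measurable_esum_coded.
- by move=> n x _; exact: esum_ge0.
rewrite esum_coded; last by move=> a; rewrite mule_ge0.
apply: eq_eseriesr => n _; have [->|[a ->]] := edges_codedP n.
  by under eq_integral do rewrite esum_set0; rewrite integral0 esum_set0.
under eq_integral do rewrite esum_set1//.
rewrite esum_set1 ?mule_ge0// ge0_integralZl//.
- by rewrite integral_indic ?setIT//; exact: measurable_S.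
- by apply/measurable_EFinP; apply: measurable_indic; exact: measurable_S.
Qed.

End Borel.
(** * Inequalities between powers *)

Section PowerInequalities.
Context (R : realType) (p : R) (p_gt1 : 1 < p).
Let q := p / (p - 1).

Let p_gt0 : 0 < p. Proof. exact: lt_trans p_gt1. Qed.
Let p1_gt0 : 0 < p - 1. Proof. by rewrite subr_gt0. Qed.

(** Young's inequality for [u] and [v ^ (p - 1)], cleared of denominators.  The
    other convexity inequalities for the power [p] are instances of it. *)
Lemma young_power (u v : R) : 0 <= u -> 0 <= v ->
  p * (u * v `^ (p - 1)) <= u `^ p + (p - 1) * v `^ p.
Proof.
move=> u0 v0; have q0 : 0 < q by exact: divr_gt0.
have pq : p^-1 + q^-1 = 1 by rewrite /q; field; rewrite !gt_eqF.
have := conjugate_powR u0 (powR_ge0 v (p - 1)) p_gt0 q0 pq.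
rewrite -powRrM (_ : (p - 1) * q = p); last by rewrite /q; field; rewrite gt_eqF.
move=> /(ler_wpM2l (ltW p_gt0)) /le_trans; apply; rewrite le_eqVlt; apply/orP; left.
by apply/eqP; rewrite /q; field; rewrite !gt_eqF.
Qed.

Lemma powR_increment (a b : R) : 0 <= b -> b <= a ->
  a `^ p - b `^ p <= p * ((a - b) * a `^ (p - 1)).
Proof.
move=> b0 ba; have a0 := le_trans b0 ba.
have := young_power b0 a0; rewrite -(mulr_powRB1 a0 p_gt0); lra.
Qed.

Lemma powRD_le (a b : R) : 0 <= a -> 0 <= b ->
  (a + b) `^ p <= 2 `^ p * (a `^ p + b `^ p).
Proof.
move=> a0 b0; have mono x y : 0 <= x -> x <= y -> x `^ p <= y `^ p.
  by move=> x0 xy; rewrite ge0_ler_powR ?nnegrE ?(le_trans x0 xy)// ltW.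
have [ab|/ltW ba] := leP a b.
- apply: (@le_trans _ _ ((2 * b) `^ p)); first by apply: mono; lra.
  by rewrite powRM// ler_wpM2l ?powR_ge0// lerDr powR_ge0.
- apply: (@le_trans _ _ ((2 * a) `^ p)); first by apply: mono; lra.
  by rewrite powRM// ler_wpM2l ?powR_ge0// lerDl powR_ge0.
Qed.

(** The parameter [L] balances the energy [x ^ p * w] against the term which is
    to be absorbed. *)
Lemma young_weighted (x g m w L : R) : 0 <= x -> 0 <= g -> 0 <= m ->
  0 < w -> 0 < L ->
  p * (x * g `^ (p - 1)) * m <=
  L `^ (p - 1) * (x `^ p * w) +
    (p - 1) / L * (g `^ p * (w `^ (1 - q) * m `^ q)).
Proof.
move=> x0 g0 m0 w0 L0.
(* These roots turn all the exponents into [p] and [p - 1]; the inequality is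
   then Young's for [u = (l r)^(p-1) x] and [v = g n / (l r)]. *)
pose l := L `^ p^-1; pose r := w `^ (p * (p - 1))^-1; pose n := m `^ (p - 1)^-1.
have l0 : 0 < l by exact: powR_gt0.
have r0 : 0 < r by exact: powR_gt0.
have n0 : 0 <= n by exact: powR_ge0.
have lE : l `^ p = L by rewrite -powRrM mulVf ?gt_eqF// powRr1// ltW.
have rE : r `^ (p * (p - 1)) = w.
  by rewrite -powRrM mulVf ?powRr1 ?mulf_neq0 ?gt_eqF// ltW.
have nE : n `^ (p - 1) = m by rewrite -powRrM mulVf ?gt_eqF// powRr1.
have rq : w `^ (1 - q) = (r `^ p)^-1.
  rewrite -powRN -[in LHS]rE -powRrM; congr (_ `^ _); rewrite /q; field.
  by rewrite gt_eqF.
have nq : m `^ q = n `^ p.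
  rewrite -[in LHS]nE -powRrM; congr (_ `^ _); rewrite /q; field.
  by rewrite gt_eqF.
have u0 : 0 <= (l * r) `^ (p - 1) * x by rewrite mulr_ge0// powR_ge0.
have v0 : 0 <= g * n / (l * r) by rewrite divr_ge0 ?mulr_ge0// ltW.
have lr0 : 0 < l * r by exact: mulr_gt0.
have divX (a b s : R) : 0 <= a -> 0 < b -> (a / b) `^ s = a `^ s / b `^ s.
  move=> a0 b0; rewrite powRM ?invr_ge0 ?(ltW b0)//; congr (_ * _).
  by rewrite -(powR_inv1 (ltW b0)) -powRrM mulN1r powRN.
have := young_power u0 v0; rewrite !divX ?mulr_ge0//.
have -> : (l * r) `^ (p - 1) * x * ((g * n) `^ (p - 1) / (l * r) `^ (p - 1)) =
    x * g `^ (p - 1) * m.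
  rewrite (powRM _ g0 n0) nE; field.
  by rewrite gt_eqF// powR_gt0.
have -> : ((l * r) `^ (p - 1) * x) `^ p = L `^ (p - 1) * (x `^ p * w).
  rewrite powRM ?powR_ge0// -powRrM powRM ?(ltW l0) ?(ltW r0)//.
  rewrite [(p - 1) * p]mulrC rE powRrM lE; ring.
have -> : (p - 1) * ((g * n) `^ p / (l * r) `^ p) =
    (p - 1) / L * (g `^ p * (w `^ (1 - q) * m `^ q)).
  rewrite rq nq powRM// (powRM _ (ltW l0) (ltW r0)) lE.
  have := powR_gt0 p r0; move: (r `^ p) (g `^ p) (n `^ p) => r' g' n' r'0.
  by field; rewrite !gt_eqF.
by rewrite -[p * _ * m]mulrA.
Qed.

Local Open Scope ereal_scope.

Lemma poweR_le (x y : \bar R) : 0 <= x -> x <= y -> x `^ p <= y `^ p.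
Proof.
move=> x0 xy; apply: gt0_ler_poweR => //; rewrite ?ltW//.
- by rewrite in_itv/= x0 leey.
- by rewrite in_itv/= leey (le_trans x0).
Qed.

Lemma poweRK (x : \bar R) : 0 <= x -> (x `^ p) `^ p^-1 = x.
Proof. by move=> x0; rewrite -poweRrM divff ?gt_eqF// poweRe1. Qed.

Lemma poweRVK (x : \bar R) : 0 <= x -> (x `^ p^-1) `^ p = x.
Proof. by move=> x0; rewrite -poweRrM mulVf ?gt_eqF// poweRe1. Qed.

Lemma poweRV_le (x y : \bar R) : 0 <= x -> x <= y -> x `^ p^-1 <= y `^ p^-1.
Proof.
move=> x0 xy; apply: gt0_ler_poweR => //; rewrite ?invr_ge0 ?ltW//.
- by rewrite in_itv/= x0 leey.
- by rewrite in_itv/= leey (le_trans x0).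
Qed.

End PowerInequalities.
(** * The Hardy inequality *)

Section HardyInequality.
Context (R : realType) (T : rooted_tree) (p : R) (p_gt1 : 1 < p).
Context (pi : edge T -> R) (pi_gt0 : forall a, 0 < pi a).
Context (mu : {finite_measure set (borel_tbar T) -> \bar R}).
Let q := p / (p - 1).
Implicit Types (phi : edge T -> R) (a b : edge T) (x : tbar T).
Local Open Scope ereal_scope.

Let p_gt0 : (0 < p)%R. Proof. exact: lt_trans p_gt1. Qed.
Let p1_gt0 : (0 < p - 1)%R. Proof. by rewrite subr_gt0. Qed.

Definition carleson_weight b : \bar R := (pi b `^ (1 - q))%:E * mu (S_ b) `^ q.

Lemma carleson_weight_ge0 b : 0 <= carleson_weight b.
Proof. by rewrite mule_ge0 ?poweR_ge0// lee_fin powR_ge0. Qed.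

Lemma mu_S_fin a : mu (S_ a) \is a fin_num.
Proof. by apply: fin_num_measure; exact: measurable_S. Qed.

Definition branch_mass a : R := fine (mu (S_ a)).

Lemma branch_massE a : mu (S_ a) = (branch_mass a)%:E.
Proof. by rewrite fineK// mu_S_fin. Qed.

Lemma branch_mass_ge0 a : (0 <= branch_mass a)%R.
Proof. exact: fine_ge0. Qed.

Lemma carleson_weightE b :
  carleson_weight b = (pi b `^ (1 - q) * branch_mass b `^ q)%:E.
Proof. by rewrite /carleson_weight branch_massE. Qed.

(** The image of [phi] at the far end of [a]. *)
Definition branch_sum phi a : R := fine (\esum_(b in edge_sub a) (phi b)%:E).

Definition power_increment phi a : R :=
  (branch_sum phi a `^ p - (branch_sum phi a - phi a) `^ p)%R.

Section Nonnegative.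
Context (phi : edge T -> R) (phi_ge0 : forall a, (0 <= phi a)%R).
Let phi_ge0E a : 0 <= (phi a)%:E. Proof. by rewrite lee_fin. Qed.
Hint Resolve phi_ge0E : core.
Local Notation g := (branch_sum phi).
Local Notation dg := (power_increment phi).

Lemma branch_sumE a : (g a)%:E = \esum_(b in edge_sub a) (phi b)%:E.
Proof.
rewrite fineK// esum_EFin_fin_num//.
apply: (@sub_finite_set _ _ [set b | (edge_depth b < (edge_depth a).+1)%N]).
  by move=> b /edge_sub_depth.
exact: finite_depth.
Qed.

Lemma le_branch_sum a : (phi a <= g a)%R.
Proof.
rewrite -lee_fin branch_sumE -(@esum_set1 _ _ a (fun a => (phi a)%:E))//.
by apply: esum_subset => _ ->; exact: edge_sub_refl.
Qed.

Lemma branch_sum_ge0 a : (0 <= g a)%R.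
Proof. exact: le_trans (le_branch_sum a). Qed.

Lemma power_increment_ge0 a : (0 <= dg a)%R.
Proof.
rewrite subr_ge0 ge0_ler_powR ?nnegrE ?branch_sum_ge0//.
- exact: ltW.
- by rewrite subr_ge0 le_branch_sum.
- by rewrite gerBl.
Qed.

Lemma power_increment_eq0 a : phi a = 0%R -> dg a = 0%R.
Proof. by rewrite /power_increment => ->; rewrite subr0 subrr. Qed.

Lemma power_increment_le a : (dg a <= p * (phi a * g a `^ (p - 1)))%R.
Proof.
have := @powR_increment _ _ p_gt1 (g a) (g a - phi a).
rewrite subKr; apply; first by rewrite subr_ge0 le_branch_sum.
by rewrite gerBl.
Qed.

(** The edge of depth [n] of the geodesic, if there is one, raises the partial sum
    from [g a - phi a] to [g a]. *)
Lemma telescope_truncated x n :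
  (\esum_(a in edges_to x `&` [set a | (edge_depth a < n)%N]) (phi a)%:E) `^ p =
  \esum_(a in edges_to x `&` [set a | (edge_depth a < n)%N]) (dg a)%:E.
Proof.
elim: n => [|n IH].
  rewrite (_ : _ `&` _ = set0) ?esum_set0 ?poweR0r ?gt_eqF//.
  by apply/seteqP; split=> a // [].
set A := edges_to x `&` [set a | (edge_depth a < n)%N] in IH *.
set A' := edges_to x `&` _.
have [[a xa an]|no_n] := pselect (exists2 a, edges_to x a & edge_depth a = n); last first.
  suff -> : A' = A by [].
  apply/seteqP; split=> b [xb] /=; last by move=> bn; split=> //=; exact: leqW.
  rewrite ltnS leq_eqVlt => /orP[/eqP bn|bn]; last by split.
  by exfalso; apply: no_n; exists b.
have A'a : A' `&` [set a] = [set a].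
  by apply/seteqP; split=> [b []//|_ ->]; split=> //; split=> //=; rewrite an.
have A'Na : A' `&` ~` [set a] = A.
  apply/seteqP; split=> b /=.
    move=> [[xb /=]]; rewrite ltnS leq_eqVlt => /orP[/eqP bn|bn ba]; last by split.
    by case; apply: (edge_depth_inj xb xa); rewrite an.
  move=> [xb /= bn]; split; first by split=> //=; exact: leqW.
  by move=> ba; move: bn; rewrite /= ba an ltnn.
have split_a (f : edge T -> \bar R) : (forall b, 0 <= f b) ->
    \esum_(b in A') f b = f a + \esum_(b in A) f b.
  by move=> f0; rewrite (esumID [set a] A' f)// A'a A'Na esum_set1.
have gA' : \esum_(b in A') (phi b)%:E = (g a)%:E.
  rewrite branch_sumE; congr esum; apply/seteqP; split=> b /=.
    by move=> [xb /= bn]; apply/(edge_sub_edges_to b xa); rewrite an.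
  by move=> /(edge_sub_edges_to b xa)[xb]; rewrite an.
have /esym gA := split_a _ phi_ge0E; rewrite gA' in gA *.
have Afin : \esum_(b in A) (phi b)%:E \is a fin_num.
  rewrite ge0_fin_numE ?esum_ge0//; apply: (@le_lt_trans _ _ (g a)%:E).
    by rewrite -gA leeDr.
  exact: ltry.
rewrite split_a; last by move=> b; rewrite lee_fin power_increment_ge0.
move: gA IH; rewrite -(fineK Afin) => -[gA] <-.
rewrite !poweR_EFin -EFinD; congr EFin.
by rewrite /power_increment -gA (addrAC (phi a)) subrr add0r subrK.
Qed.

Lemma telescope_le x :
  (\esum_(a in edges_to x) (phi a)%:E) `^ p <= \esum_(a in edges_to x) (dg a)%:E.
Proof.
have dg0 a : 0 <= (dg a)%:E by rewrite lee_fin power_increment_ge0.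
set D := \esum_(a in edges_to x) (dg a)%:E.
have D0 : 0 <= D by exact: esum_ge0.
rewrite -[leRHS](poweRVK p_gt1)//; apply: poweR_le => //; first exact: esum_ge0.
apply: (esum_le_bounded (d := @edge_depth T)) => // n.
rewrite -(poweRK p_gt1 (esum_ge0 _))//; apply: poweRV_le => //.
  exact: poweR_ge0.
by rewrite telescope_truncated; apply: esum_subset => a [].
Qed.

(** [telescope_le] at the far end of [a]. *)
Lemma branch_sum_le a : (g a `^ p)%:E <= \esum_(b in edge_sub a) (dg b)%:E.
Proof.
have := telescope_le (inl (exist _ (far_end a) (far_end_neq a))).
by rewrite [X in X `^ p](_ : _ = (g a)%:E)// branch_sumE.
Qed.

Section Carleson.
Context (n0 : nat) (K : R) (K_gt0 : (0 < K)%R).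
Context (carleson : forall a, (n0 <= edge_depth a)%N ->
  \esum_(b in [set b | edge_sub b a]) carleson_weight b <= K%:E * mu (S_ a)).

(** Twice the factor [L ^ (p - 1)] of [young_weighted], for the [L] with
    [(p - 1) / L * K = 1 / 2]. *)
Definition hardy_const : R := (2 * (2 * (p - 1) * K) `^ (p - 1))%R.

Lemma hardy_const_ge0 : (0 <= hardy_const)%R.
Proof. by rewrite mulr_ge0// powR_ge0. Qed.

(** The sum over depth less than [N] is finite, so that the half of it which
    comes back after exchanging the sums can be subtracted. *)
Lemma truncated_energy N :
  (forall a, (edge_depth a < n0)%N -> phi a = 0%R) ->
  \esum_(a in [set a | (edge_depth a < N)%N]) ((dg a)%:E * mu (S_ a)) <=
  hardy_const%:E * \esum_(a in [set: edge T]) (phi a `^ p * pi a)%:E.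
Proof.
move=> phi0; set A := [set a | _]; set X := \esum_(a in A) _.
set E := \esum_(a in [set: edge T]) _.
pose L := (2 * (p - 1) * K)%R; have L0 : (0 < L)%R by rewrite !mulr_gt0.
have m0 := branch_mass_ge0; have dg0 := power_increment_ge0.
have Xfin : X \is a fin_num.
  rewrite /X; under eq_esum do rewrite branch_massE -EFinM.
  by apply: esum_EFin_fin_num => [|a]; [exact: finite_depth|rewrite mulr_ge0].
pose c b : R := (pi b `^ (1 - q) * branch_mass b `^ q)%R.
have c0 b : (0 <= c b)%R by rewrite mulr_ge0 ?powR_ge0.
have E0 : 0 <= E by apply: esum_ge0 => a _; rewrite lee_fin mulr_ge0 ?powR_ge0// ltW.
have young : X <= (L `^ (p - 1))%:E * E +
    ((p - 1) / L)%:E * \esum_(a in A) ((c a)%:E * (g a `^ p)%:E).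
  apply: (@le_trans _ _ (\esum_(a in A) ((L `^ (p - 1))%:E * (phi a `^ p * pi a)%:E +
      ((p - 1) / L)%:E * ((c a)%:E * (g a `^ p)%:E)))).
    apply: le_esum => a _; rewrite branch_massE -!EFinM -EFinD lee_fin.
    have := young_weighted p_gt1 (phi_ge0 a) (branch_sum_ge0 a) (m0 a) (pi_gt0 a) L0.
    rewrite -/q [(c a * _)%R]mulrC => /(le_trans _); apply.
    by apply: ler_wpM2r => //; exact: power_increment_le.
  rewrite esumD; last 2 first.
  - by move=> a _; rewrite -EFinM lee_fin !mulr_ge0 ?powR_ge0// ltW.
  - by move=> a _; rewrite -!EFinM lee_fin !mulr_ge0 ?invr_ge0 ?powR_ge0// ltW.
  rewrite !esumZl ?divr_ge0 ?powR_ge0 ?(ltW p1_gt0) ?(ltW L0)//; last 2 first.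
  - by move=> a; rewrite -EFinM lee_fin mulr_ge0 ?powR_ge0.
  - by move=> a; rewrite lee_fin mulr_ge0 ?powR_ge0// ltW.
  apply: leeD2r; apply: lee_wpmul2l; rewrite ?lee_fin ?powR_ge0//.
  exact: esum_subset.
have swap : \esum_(a in A) ((c a)%:E * (g a `^ p)%:E) <= K%:E * X.
  apply: (@le_trans _ _ (\esum_(a in A) \esum_(b in edge_sub a) ((c a)%:E * (dg b)%:E))).
    apply: le_esum => a _; rewrite esumZl//.
    by apply: lee_wpmul2l; [rewrite lee_fin|exact: branch_sum_le].
  rewrite (@esum_exchange _ _ _ A (@edge_sub T) A (fun b => [set a | edge_sub a b /\ A a]));
    last 2 first.
  - by move=> a b; rewrite -EFinM lee_fin mulr_ge0.
  - move=> a b; split=> [[Aa ab]|[_ []]//]; split=> //.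
    exact: leq_ltn_trans (edge_sub_depth ab) Aa.
  rewrite -esumZl ?(ltW K_gt0)//; last first.
    by move=> a; rewrite branch_massE -EFinM lee_fin mulr_ge0.
  apply: le_esum => b _; under eq_esum do rewrite muleC.
  rewrite esumZl//.
  have [/phi0/power_increment_eq0->|n0b] := ltnP (edge_depth b) n0.
    by rewrite !mul0e mule0.
  rewrite muleCA; apply: lee_wpmul2l; first by rewrite lee_fin.
  apply: le_trans (carleson n0b); under [leRHS]eq_esum do rewrite carleson_weightE.
  by apply: esum_subset => a [].
have {}young : X <= (L `^ (p - 1))%:E * E + ((p - 1) / L)%:E * (K%:E * X).
  apply: le_trans young _; apply: leeD2l; apply: lee_wpmul2l => //.
  by rewrite lee_fin divr_ge0// ltW.
have hc0 : (0 < hardy_const)%R by rewrite mulr_gt0// powR_gt0.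
have [/eqP Efin|Einf] := eqVneq E +oo.
  by rewrite (eqP Efin) gt0_muley ?lte_fin// leey.
have {}Einf : E \is a fin_num by rewrite ge0_fin_numE// ltey.
rewrite -(fineK Einf) -(fineK Xfin) -!EFinM -EFinD !lee_fin in young *.
have e : ((p - 1) / L * (K * fine X) = fine X / 2)%R.
  by rewrite /L; field; rewrite !gt_eqF.
rewrite e in young; rewrite /hardy_const -/L; lra.
Qed.

Lemma hardy_inequality_tail :
  (forall a, (edge_depth a < n0)%N -> phi a = 0%R) ->
  \int[mu]_x ((\esum_(a in edges_to (x : tbar T)) (phi a)%:E) `^ p) <=
  hardy_const%:E * \esum_(a in [set: edge T]) (phi a `^ p * pi a)%:E.
Proof.
move=> phi0; have dg0 a : 0 <= (dg a)%:E by rewrite lee_fin power_increment_ge0.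
apply: (@le_trans _ _ (\int[mu]_x (\esum_(a in edges_to (x : tbar T)) (dg a)%:E))).
  apply: ge0_le_integral => //.
  - by move=> x _; exact: poweR_ge0.
  - by apply: (measurableT_comp (measurable_poweR p)); exact: measurable_esum_edges_to.
  - exact: measurable_esum_edges_to.
  - by move=> x _; exact: telescope_le.
rewrite integral_esum_edges_to//.
apply: (esum_le_bounded (d := @edge_depth T)) => [a|n]; first by rewrite mule_ge0.
by rewrite setTI; exact: truncated_energy.
Qed.

End Carleson.
End Nonnegative.

(** Edges of depth less than [n0] only contribute a bounded function. *)
Lemma hardy_inequality phi (n0 : nat) (K : R) : (forall a, (0 <= phi a)%R) ->
  (0 < K)%R ->
  (forall a, (n0 <= edge_depth a)%N ->
    \esum_(b in [set b | edge_sub b a]) carleson_weight b <= K%:E * mu (S_ a)) ->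
  \int[mu]_x ((\esum_(a in edges_to (x : tbar T)) (phi a)%:E) `^ p) <=
  (2 `^ p)%:E *
    ((\esum_(a in [set a : edge T | (edge_depth a < n0)%N]) (phi a)%:E) `^ p *
       mu setT +
     (hardy_const K)%:E * \esum_(a in [set: edge T]) (phi a `^ p * pi a)%:E).
Proof.
move=> phi_ge0 K0 carleson.
have phi_ge0E a : 0 <= (phi a)%:E by rewrite lee_fin.
pose tail a : R := if (edge_depth a < n0)%N then 0%R else phi a.
have tail_ge0 a : (0 <= tail a)%R by rewrite /tail; case: ifP.
have tailE a : 0 <= (tail a)%:E by rewrite lee_fin.
set H := \esum_(a in [set a | _]) _.
set F := fun x : borel_tbar T => \esum_(a in edges_to x) (phi a)%:E.
have H0 : 0 <= H by exact: esum_ge0.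
have Hfin : H \is a fin_num by apply: esum_EFin_fin_num; [exact: finite_depth|].
pose G x := \esum_(a in edges_to (x : tbar T)) (tail a)%:E.
have G0 x : 0 <= G x by exact: esum_ge0.
have FG x : F x `^ p <= (2 `^ p)%:E * (H `^ p + G x `^ p).
  apply: (@le_trans _ _ ((H + G x) `^ p)).
    apply: (poweR_le p_gt1); first exact: esum_ge0.
    rewrite /F (esumID [set a | (edge_depth a < n0)%N] _ (fun a => (phi a)%:E))//.
    apply: leeD; first by apply: esum_subset => a [].
    apply: (@le_trans _ _ (\esum_(a in edges_to x `&`
        ~` [set a | (edge_depth a < n0)%N]) (tail a)%:E)).
      by apply: le_esum => a [_ /negP/negPf /= an]; rewrite /tail an.
    by apply: esum_subset => a [].
  move: (G0 x); case: (G x) => [y| |]// y0.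
    rewrite -(fineK Hfin) -EFinD !poweR_EFin -EFinD -EFinM lee_fin.
    by apply: powRD_le => //; exact: fine_ge0.
  have notNy (y : \bar R) : 0 <= y -> y != -oo by case: y.
  rewrite addey ?notNy// poweRyr ?gt_eqF// addey ?notNy ?poweR_ge0//.
  by rewrite gt0_muley ?lte_fin ?powR_gt0 ?leey.
have mG : measurable_fun [set: borel_tbar T] ((fun x => G x `^ p) : borel_tbar T -> \bar R).
  by apply: (measurableT_comp (measurable_poweR p)); exact: measurable_esum_edges_to.
have mc : measurable_fun [set: borel_tbar T] ((fun _ => H `^ p) : borel_tbar T -> \bar R).
  exact: measurable_cst.
have HG0 x : 0 <= H `^ p + G x `^ p by rewrite adde_ge0 ?poweR_ge0.
apply: (@le_trans _ _ (\int[mu]_x ((2 `^ p)%:E * (H `^ p + G x `^ p)))).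
  apply: ge0_le_integral => //.
  - by move=> x _; exact: poweR_ge0.
  - by apply: (measurableT_comp (measurable_poweR p)); exact: measurable_esum_edges_to.
  - by apply: emeasurable_funM => //; exact: emeasurable_funD.
  - by move=> x _; exact: FG.
rewrite ge0_integralZl_EFin ?powR_ge0//; last exact: emeasurable_funD.
apply: lee_wpmul2l; first by rewrite lee_fin powR_ge0.
rewrite ge0_integralD//; last 2 first.
- by move=> x _; exact: poweR_ge0.
- by move=> x _; exact: poweR_ge0.
rewrite integral_cst//; apply: leeD2l.
apply: le_trans (hardy_inequality_tail tail_ge0 K0 carleson _) _.
  by move=> a an; rewrite /tail an.
apply: lee_wpmul2l; first by rewrite lee_fin hardy_const_ge0.
apply: le_esum => a _; rewrite lee_fin ler_wpM2r ?(ltW (pi_gt0 a))//.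
rewrite /tail; case: ifP => // _; rewrite powR0 ?powR_ge0//.
by rewrite gt_eqF.
Qed.

End HardyInequality.

(** * The Hardy operator *)

Section HardyOperator.
Context (R : realType) (T : rooted_tree).
Implicit Types (phi psi : edge T -> R) (x : borel_tbar T).
Local Open Scope ereal_scope.

Lemma measurable_hardy phi :
  measurable_fun [set: borel_tbar T] (hardy phi : borel_tbar T -> R).
Proof.
apply: (measurableT_comp (fine_measurable measurableT)).
apply: emeasurable_funB; apply: measurable_esum_edges_to => a.
  exact: funepos_ge0.
exact: funeneg_ge0.
Qed.

Definition abs_hardy phi x : \bar R :=
  \esum_(a in edges_to (x : tbar T)) (`|phi a|)%:E.

Lemma abs_hardy_ge0 phi x : 0 <= abs_hardy phi x.
Proof. by apply: esum_ge0 => a _; rewrite lee_fin. Qed.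

Lemma measurable_abs_hardy phi :
  measurable_fun [set: borel_tbar T] (abs_hardy phi : borel_tbar T -> \bar R).
Proof. by apply: measurable_esum_edges_to => a; rewrite lee_fin. Qed.

(** This also holds where the sum does not converge absolutely: the right-hand
    side is then infinite. *)
Lemma normr_hardy_le phi x : (`|hardy phi x|)%:E <= abs_hardy phi x.
Proof.
have -> : abs_hardy phi x = \esum_(a in edges_to (x : tbar T)) (EFin \o phi)^\+ a +
    \esum_(a in edges_to (x : tbar T)) (EFin \o phi)^\- a.
  rewrite -esumD; [|by move=> *; exact: funepos_ge0|by move=> *; exact: funeneg_ge0].
  apply: eq_esum => a _.
  by rewrite -[RHS]/(((EFin \o phi)^\+ \+ (EFin \o phi)^\-) a) -fune_abse.
rewrite /hardy; set A := \esum_(a in _) _; set B := \esum_(a in _) _.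
have : 0 <= A by apply: esum_ge0 => *; exact: funepos_ge0.
have : 0 <= B by apply: esum_ge0 => *; exact: funeneg_ge0.
case: A B => [u| |] [v| |]//=; rewrite ?normr0 ?leey// !lee_fin => v0 u0.
by rewrite (le_trans (ler_normB _ _))// !ger0_norm.
Qed.

Lemma hardyB phi psi x :
  summable (edges_to (x : tbar T)) (EFin \o phi) ->
  summable (edges_to (x : tbar T)) (EFin \o psi) ->
  hardy (fun a => phi a - psi a)%R x = (hardy phi x - hardy psi x)%R.
Proof.
move=> sphi spsi.
have sp1 := summable_funepos sphi; have sn1 := summable_funeneg sphi.
have sp2 := summable_funepos spsi; have sn2 := summable_funeneg spsi.
have p0 (f : edge T -> \bar R) a : 0 <= f^\+ a by exact: funepos_ge0.
have n0 (f : edge T -> \bar R) a : 0 <= f^\- a by exact: funeneg_ge0.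
have fin (f : edge T -> \bar R) : summable (edges_to (x : tbar T)) f ->
    (forall a, 0 <= f a) -> \esum_(a in edges_to (x : tbar T)) f a \is a fin_num.
  move=> + f0; rewrite summableE; under eq_esum => a _ do rewrite gee0_abs//.
  by [].
have := @esumB _ _ _ _ _ (summableD sp1 sn2) (summableD sn1 sp2)
  (fun a _ => adde_ge0 (p0 _ a) (n0 _ a)) (fun a _ => adde_ge0 (n0 _ a) (p0 _ a)).
(* [phi - psi] as a difference of two nonnegative summable families. *)
have -> : ((EFin \o phi)^\+ \+ (EFin \o psi)^\-) \- ((EFin \o phi)^\- \+ (EFin \o psi)^\+) =
    EFin \o (fun a => phi a - psi a)%R.
  apply/funext => a; rewrite /= !funeposE !funenegE /=.
  rewrite -!EFin_max -!EFinD; congr EFin.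
  by rewrite /Num.max; do !case: ifPn; rewrite -?leNgt; lra.
rewrite /hardy => ->; rewrite !esumD//.
have := fin _ sp1 (p0 _); have := fin _ sn1 (n0 _).
have := fin _ sp2 (p0 _); have := fin _ sn2 (n0 _).
set A := \esum_(a in _) _; set B := \esum_(a in _) _.
set C := \esum_(a in _) _; set D := \esum_(a in _) _.
move=> /fineK<- /fineK<- /fineK<- /fineK<- /=.
by ring.
Qed.

Lemma ge0_hardyE phi x : (forall a, (0 <= phi a)%R) ->
  summable (edges_to (x : tbar T)) (EFin \o phi) ->
  (hardy phi x)%:E = \esum_(a in edges_to (x : tbar T)) (phi a)%:E.
Proof.
move=> phi0; rewrite summableE => sphi; rewrite /hardy.
have -> : \esum_(a in edges_to (x : tbar T)) (EFin \o phi)^\- a = 0.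
  by apply: esum1 => a _; rewrite (ge0_funenegE (D := setT)) ?inE// => b _; rewrite lee_fin.
have -> : \esum_(a in edges_to (x : tbar T)) (EFin \o phi)^\+ a =
    \esum_(a in edges_to (x : tbar T)) (phi a)%:E.
  by apply: eq_esum => a _; rewrite (ge0_funeposE (D := setT)) ?inE// => b _; rewrite lee_fin.
rewrite sube0 fineK//; move: sphi; under eq_esum => a _ do rewrite gee0_abs ?lee_fin//.
by [].
Qed.

End HardyOperator.
(** * Convergence along filters *)

Section Convergence.
Context (R : realType).

Lemma cvge0P (u : nat -> \bar R) : (forall n, 0 <= u n)%E ->
  u n @[n --> \oo] --> 0%E <->
  forall e : R, 0 < e -> exists N, forall n, (N <= n)%N -> (u n <= e%:E)%E.
Proof.
move=> u0; split=> [cu e e0|H A A0].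
  have : nbhs (0%E : \bar R) [set y | (y < e%:E)%E].
    by apply: open_nbhs_nbhs; split; [exact: open_ereal_lt_ereal|rewrite /= lte_fin].
  by move=> /cu[N _ HN]; exists N => n /HN/ltW.
have /nbhs_ballP[e /= e0 eA] := A0 : nbhs (0 : R) (fun r => A r%:E).
have [|N HN] := H (e / 2); first by rewrite divr_gt0.
exists N => // n /HN un; change (A (u n)); move: (u0 n) un; case: (u n) => [r| |]//=.
rewrite !lee_fin => r0 re; apply: (eA r).
by rewrite /ball /= sub0r normrN ger0_norm// (le_lt_trans re)// ltr_pdivrMr// ltr_pMr// ltr1n.
Qed.

Lemma filter_finite (I : eqType) (J : Type) (U : set_system J) (X : set I)
    (P : I -> set J) : Filter U -> finite_set X ->
  (forall i, X i -> U (P i)) -> U [set k | forall i, X i -> P i k].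
Proof.
move=> FU /finite_seqP[s ->]; elim: s => [|i s IH] UP.
  by apply: filterS (@filterT _ U _) => k _ i.
have Us : U [set k | forall j, j \in s -> P j k].
  by apply: IH => j js; apply: UP; rewrite /= inE js orbT.
have Ui : U (P i) by apply: UP; rewrite /= inE eqxx.
apply: filterS (filterI Ui Us) => k [Pi Ps] j /=.
by rewrite inE => /orP[/eqP->|/Ps].
Qed.

(** Along an ultrafilter every bounded sequence converges. *)
Lemma ultra_bounded_cvg (J : Type) (U : set_system J) (f : J -> R) (B : R) :
  UltraFilter U -> (forall k, `|f k| <= B) ->
  exists l, forall e, 0 < e -> U [set k | `|f k - l| < e].
Proof.
move=> UU fB; have fU : (f @ U) `[(- B), B]%classic.
  apply: (@filterS _ U _ setT); last exact: filterT.
  by move=> k _; rewrite /= in_itv/= -ler_norml fB.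
have [l [_ cl]] := @segment_compact R (- B) B (f @ U) _ fU.
exists l => e e0.
have [//|nU] := in_ultra_setVsetC [set k | `|f k - l| < e] UU.
have fnU : (f @ U) (f @` ~` [set k | `|f k - l| < e]).
  by apply: (@filterS _ U _ (~` [set k | `|f k - l| < e])) => // k ?; exists k.
have [_ [[k + <-] /=]] := cl _ _ fnU (nbhsx_ballx l _ e0).
by rewrite /ball/= distrC.
Qed.

End Convergence.

(** * Boundedness *)

Section Sufficiency.
Context (R : realType) (T : rooted_tree) (p : R) (p_gt1 : 1 < p).
Context (pi : edge T -> R) (pi_gt0 : forall a, 0 < pi a).
Context (mu : {finite_measure set (borel_tbar T) -> \bar R}).
Implicit Types (phi psi : edge T -> R) (a b : edge T).
Local Open Scope ereal_scope.
Local Notation energy phi := (\esum_(a in [set: edge T]) (`|phi a| `^ p * pi a)%:E).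
Local Notation term := (carleson_weight p pi mu).

Let p_gt0 : (0 < p)%R. Proof. exact: lt_trans p_gt1. Qed.
Let p1_gt0 : (0 < p - 1)%R. Proof. by rewrite subr_gt0. Qed.

(** When [mu (S_ a)] vanishes the ratio is [0 * +oo = 0], because every branch
    [S_ b] below [a] is then null as well. *)
Lemma mass_ratio_leE a (K : R) : (0 <= K)%R ->
  mass_ratio p pi mu a <= K%:E <->
  \esum_(b in [set b | edge_sub b a]) term b <= K%:E * mu (S_ a).
Proof.
move=> K0; have s0 : 0 <= \esum_(b in [set b | edge_sub b a]) term b.
  by apply: esum_ge0 => b _; exact: carleson_weight_ge0.
have -> : mass_ratio p pi mu a =
    (\esum_(b in [set b | edge_sub b a]) term b) / (branch_mass mu a)%:E.
  by congr (_ / _); exact: branch_massE.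
rewrite branch_massE; move: (branch_mass mu a) (branch_mass_ge0 mu a) => m.
rewrite le_eqVlt => /orP[/eqP<-|m0]; last by rewrite inver gt_eqF// lee_pdivrMr.
rewrite inver eqxx mule0; move: s0; rewrite le_eqVlt => /orP[/eqP<-|s0].
  by rewrite mul0e lexx lee_fin.
by rewrite gt0_muley// leye_eq; split=> //; rewrite leNgt s0.
Qed.

Lemma sup_mass_ratio_ge0 n : 0 <= sup_mass_ratio p pi mu n.
Proof. by apply: ereal_sup_ubound; left. Qed.

Definition carleson_from n (K : R) := forall a, (n <= edge_depth a)%N ->
  \esum_(b in [set b | edge_sub b a]) term b <= K%:E * mu (S_ a).

Lemma carleson_from_limit : sup_mass_ratio p pi mu n @[n --> \oo] --> 0 ->
  forall K : R, (0 < K)%R -> exists n, carleson_from n K.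
Proof.
move=> /(cvge0P sup_mass_ratio_ge0) H K K0; have [n Hn] := H K K0.
exists n => a na; apply/mass_ratio_leE; first exact: ltW.
by apply: le_trans (Hn n (leqnn _)); apply: ereal_sup_ubound; right; exists a.
Qed.

Lemma hardy_const_small (t : R) : (0 < t)%R ->
  exists2 K : R, (0 < K)%R & hardy_const p K = t.
Proof.
move=> t0; exists ((t / 2) `^ (p - 1)^-1 / (2 * (p - 1)))%R.
  by rewrite divr_gt0 ?powR_gt0 ?divr_gt0 ?mulr_gt0.
rewrite /hardy_const mulrCA divff ?mulr1 ?gt_eqF ?mulr_gt0//.
rewrite -powRrM mulVf ?gt_eqF// powRr1 ?divr_ge0 ?ltW//.
by rewrite mulrCA divff ?mulr1.
Qed.

Lemma abs_hardy_inequality n (K : R) phi : (0 < K)%R -> carleson_from n K ->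
  \int[mu]_x (abs_hardy phi x `^ p) <= (2 `^ p)%:E *
    ((\esum_(a in [set a : edge T | (edge_depth a < n)%N]) (`|phi a|)%:E) `^ p *
       mu setT + (hardy_const p K)%:E * energy phi).
Proof. by move=> K0 H; exact: (hardy_inequality p_gt1 pi_gt0). Qed.

Lemma head_fin n phi :
  \esum_(a in [set a : edge T | (edge_depth a < n)%N]) (`|phi a|)%:E \is a fin_num.
Proof. by apply: esum_EFin_fin_num => //; exact: finite_depth. Qed.

Lemma energy_ge0 phi : 0 <= energy phi.
Proof. by apply: esum_ge0 => a _; rewrite lee_fin mulr_ge0 ?powR_ge0// ltW. Qed.

Lemma energy_le_term phi a : (`|phi a| `^ p * pi a)%:E <= energy phi.
Proof.
have f0 b : 0 <= (`|phi b| `^ p * pi b)%:E by rewrite lee_fin mulr_ge0 ?powR_ge0// ltW.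
rewrite -(@esum_set1 _ _ a (fun a => (`|phi a| `^ p * pi a)%:E))//.
exact: esum_subset.
Qed.

Lemma normr_le_energy phi a (e : R) : energy phi <= e%:E ->
  (`|phi a| <= e `^ p^-1 * (pi a) `^ (- p^-1))%R.
Proof.
move=> /(le_trans (energy_le_term phi a)); rewrite lee_fin => le_e.
have e0 : (0 <= e)%R by rewrite (le_trans _ le_e)// mulr_ge0 ?powR_ge0// ltW.
have : (`|phi a| `^ p <= e / pi a)%R by rewrite ler_pdivlMr.
move=> /(ge0_ler_powR (r := p^-1)); rewrite invr_ge0 ltW// !nnegrE powR_ge0.
rewrite divr_ge0 ?(ltW (pi_gt0 a))// => /(_ isT isT isT).
rewrite -powRrM divff ?gt_eqF// powRr1// powRM ?invr_ge0 ?(ltW (pi_gt0 a))//.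
by rewrite -(powR_inv1 (ltW (pi_gt0 a))) -powRrM mulN1r.
Qed.

Lemma energyD_le phi psi :
  energy (fun a => phi a - psi a)%R <= (2 `^ p)%:E * (energy phi + energy psi).
Proof.
have t0 (f : edge T -> R) a : 0 <= (`|f a| `^ p * pi a)%:E.
  by rewrite lee_fin mulr_ge0 ?powR_ge0// ltW.
rewrite -esumD// -esumZl ?powR_ge0//; last by move=> a; rewrite adde_ge0.
apply: le_esum => a _; rewrite -EFinD -EFinM lee_fin -mulrDl mulrA.
apply: ler_wpM2r; first by rewrite ltW.
apply: le_trans (powRD_le p_gt1 (normr_ge0 _) (normr_ge0 _)).
by rewrite ge0_ler_powR ?nnegrE ?ler_normB// ?ltW// addr_ge0.
Qed.

Lemma abs_hardy_fin n (K : R) phi : (0 < K)%R -> carleson_from n K ->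
  in_lpi p pi phi -> \int[mu]_x (abs_hardy phi x `^ p) < +oo.
Proof.
move=> K0 H philp; apply: le_lt_trans (abs_hardy_inequality phi K0 H) _.
have E : energy phi \is a fin_num by rewrite ge0_fin_numE ?energy_ge0.
have mT : mu setT \is a fin_num by exact: fin_num_measure.
rewrite -(fineK (head_fin n phi)) -(fineK E) -(fineK mT) poweR_EFin.
by rewrite -!EFinM ltry.
Qed.

Lemma measurable_abs_hardy_power phi : measurable_fun [set: borel_tbar T]
  ((fun x => abs_hardy phi x `^ p) : borel_tbar T -> \bar R).
Proof.
exact: (measurableT_comp (measurable_poweR p) (measurable_abs_hardy phi)).
Qed.

Lemma ae_summable phi : \int[mu]_x (abs_hardy phi x `^ p) < +oo ->
  {ae mu, forall x : borel_tbar T, summable (edges_to (x : tbar T)) (EFin \o phi)}.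
Proof.
move=> fin; have : mu.-integrable [set: borel_tbar T] (fun x => abs_hardy phi x `^ p).
  apply/integrableP; split; first exact: measurable_abs_hardy_power.
  by under eq_integral do rewrite gee0_abs ?poweR_ge0//.
move=> /(integrable_ae measurableT); apply: filterS => x /(_ I) xfin.
apply: (@lty_poweRy _ _ p); first by rewrite gt_eqF.
by rewrite -ge0_fin_numE ?poweR_ge0.
Qed.

Lemma Lnorm_le_abs_hardy (f : borel_tbar T -> R) phi :
  measurable_fun [set: borel_tbar T] f ->
  {ae mu, forall x, (`|f x|)%:E <= abs_hardy phi x} ->
  'N[mu]_p%:E [EFin \o f] <= (\int[mu]_x (abs_hardy phi x `^ p)) `^ p^-1.
Proof.
move=> mf fphi; rewrite unlock; apply: poweRV_le => //.
  by apply: integral_ge0 => x _; exact: poweR_ge0.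
apply: ae_ge0_le_integral => //.
- by move=> x _; exact: poweR_ge0.
- apply: (measurableT_comp (measurable_poweR p)); apply: measurableT_comp => //.
  exact/measurable_EFinP.
- by move=> x _; exact: poweR_ge0.
- exact: measurable_abs_hardy_power.
- by apply: filterS fphi => x fx _; apply: poweR_le.
Qed.

Lemma hardy_well_defined_of_carleson n (K : R) : (0 < K)%R -> carleson_from n K ->
  hardy_well_defined p pi mu.
Proof.
move=> K0 H phi philp; have fin := abs_hardy_fin K0 H philp.
split; first exact: ae_summable.
rewrite inE; apply/andP; split; rewrite inE; first exact: measurable_hardy.
apply: (@le_lt_trans _ _ ((\int[mu]_x (abs_hardy phi x `^ p)) `^ p^-1)).
  apply: Lnorm_le_abs_hardy; first exact: measurable_hardy.
  by apply/aeW => x; exact: normr_hardy_le.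
exact: poweR_lty.
Qed.

Lemma hardy_bounded_of_carleson n (K : R) : (0 < K)%R -> carleson_from n K ->
  hardy_bounded p pi mu.
Proof.
move=> K0 H; set A := [set a : edge T | (edge_depth a < n)%N].
pose s : R := fine (\esum_(a in A) (pi a `^ (- p^-1))%:E).
have sE : \esum_(a in A) (pi a `^ (- p^-1))%:E = s%:E.
  rewrite fineK//; apply: esum_EFin_fin_num => [|a]; last exact: powR_ge0.
  exact: finite_depth.
have s0 : (0 <= s)%R.
  by rewrite -lee_fin -sE; apply: esum_ge0 => a _; rewrite lee_fin powR_ge0.
pose m : R := fine (mu setT).
have mE : mu setT = m%:E by rewrite fineK// fin_num_measure.
have m0 : (0 <= m)%R by exact: fine_ge0.
pose B : R := (2 `^ p * (s `^ p * m + hardy_const p K))%R.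
exists (B `^ p^-1)%R => phi philp.
pose e : R := fine (energy phi).
have eE : energy phi = e%:E by rewrite fineK// ge0_fin_numE ?energy_ge0.
have e0 : (0 <= e)%R by rewrite -lee_fin -eE energy_ge0.
rewrite /lpi_norm eE poweR_EFin -EFinM -powRM//; last first.
  by rewrite mulr_ge0 ?addr_ge0 ?mulr_ge0 ?powR_ge0// hardy_const_ge0.
apply: le_trans (Lnorm_le_abs_hardy (phi := phi) _ _) _.
- exact: measurable_hardy.
- by apply/aeW => x; exact: normr_hardy_le.
rewrite -poweR_EFin; apply: poweRV_le => //.
  by apply: integral_ge0 => x _; exact: poweR_ge0.
apply: le_trans (abs_hardy_inequality phi K0 H) _.
rewrite -/A eE mE.
have head : \esum_(a in A) (`|phi a|)%:E <= (e `^ p^-1 * s)%:E.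
  rewrite EFinM -sE -esumZl ?powR_ge0//; last by move=> a; rewrite lee_fin powR_ge0.
  by apply: le_esum => a _; rewrite -EFinM lee_fin normr_le_energy// eE.
have head0 : 0 <= \esum_(a in A) (`|phi a|)%:E by exact: esum_ge0.
apply: (@le_trans _ _ ((2 `^ p)%:E *
    (((e `^ p^-1 * s) `^ p)%:E * m%:E + (hardy_const p K)%:E * e%:E))).
  apply: lee_wpmul2l; first by rewrite lee_fin powR_ge0.
  by apply: leeD2r; apply: lee_wpmul2r => //; rewrite -poweR_EFin; exact: poweR_le.
rewrite -!EFinM lee_fin powRM ?powR_ge0// -powRrM mulVf ?gt_eqF//.
by rewrite powRr1// le_eqVlt; apply/orP; left; apply/eqP; rewrite /B; ring.
Qed.

End Sufficiency.
(** * Compactness from the limit condition *)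

Section Compactness.
Context (R : realType) (T : rooted_tree) (p : R) (p_gt1 : 1 < p).
Context (pi : edge T -> R) (pi_gt0 : forall a, 0 < pi a).
Context (mu : {finite_measure set (borel_tbar T) -> \bar R}).
Implicit Types (phi psi : edge T -> R) (a b : edge T).
Local Open Scope ereal_scope.
Local Notation energy phi := (\esum_(a in [set: edge T]) (`|phi a| `^ p * pi a)%:E).

Let p_gt0 : (0 < p)%R. Proof. exact: lt_trans p_gt1. Qed.
Let p1_gt0 : (0 < p - 1)%R. Proof. by rewrite subr_gt0. Qed.

Section PointwiseLimit.
Context (U : set_system nat) {UU : UltraFilter U}.
Context (phi : nat -> edge T -> R) (psi : edge T -> R) (e : R).
Context (phi_e : forall k, energy (phi k) <= e%:E).
Context (phi_psi : forall a (d : R), (0 < d)%R -> U [set k | (`|phi k a - psi a| < d)%R]).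

Let near_head n (d : R) : (0 < d)%R ->
  U [set k | forall a, (edge_depth a < n)%N -> (`|phi k a - psi a| < d)%R].
Proof.
move=> d0.
have H := @filter_finite _ _ U _ (fun a => [set k | (`|phi k a - psi a| < d)%R])
  (@filter_filter _ _ _) (@finite_depth T n).
by apply: H => a _; exact: phi_psi.
Qed.

Let powR_le_id (d : R) : (0 <= d <= 1)%R -> (d `^ p <= d)%R.
Proof.
move=> /andP[]; rewrite le_eqVlt => /orP[/eqP<- _|d0 d1].
  by rewrite powR0// gt_eqF.
by apply: ge1r_powR; rewrite ?d0 ?d1// ltW.
Qed.

(** On finitely many edges [psi] is as close as desired to some [phi k]; their
    energies are then compared by convexity, which costs the factor [2 ^ p]. *)
Lemma energy_limit_le : energy psi <= (2 `^ p * (e + 1))%:E.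
Proof.
have t0 (f : edge T -> R) a : 0 <= (`|f a| `^ p * pi a)%:E.
  by rewrite lee_fin mulr_ge0 ?powR_ge0// ltW.
apply: (esum_le_bounded (d := @edge_depth T)) => // n; rewrite setTI.
set A := [set a | _]; pose c : R := fine (\esum_(a in A) (pi a)%:E).
have pi0 a : 0 <= (pi a)%:E by rewrite lee_fin ltW.
have cE : \esum_(a in A) (pi a)%:E = c%:E.
  rewrite fineK//; apply: esum_EFin_fin_num => [|a]; last exact: ltW.
  exact: finite_depth.
have c0 : (0 <= c)%R by rewrite -lee_fin -cE esum_ge0.
have c1 : (0 < 1 + c)%R by rewrite ltr_pwDl.
have c1' : (0 < (1 + c)^-1)%R by rewrite invr_gt0.
have r0 a : 0 <= ((1 + c)^-1 * pi a)%:E.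
  by rewrite lee_fin mulr_ge0 ?(ltW c1')// ltW.
have [k kA] := filter_ex (near_head n c1').
apply: (@le_trans _ _ (\esum_(a in A) ((2 `^ p)%:E *
    ((`|phi k a| `^ p * pi a)%:E + ((1 + c)^-1 * pi a)%:E)))).
  apply: le_esum => a aA; rewrite -EFinD -EFinM lee_fin -mulrDl mulrA.
  apply: ler_wpM2r; first exact: ltW.
  apply: (@le_trans _ _ ((`|phi k a| + `|phi k a - psi a|) `^ p)%R).
    rewrite ge0_ler_powR ?nnegrE ?addr_ge0// ?(ltW p_gt0)//.
    by rewrite -{1}(subKr (phi k a) (psi a)) ler_normB.
  apply: le_trans (powRD_le p_gt1 (normr_ge0 _) (normr_ge0 _)) _.
  apply: ler_wpM2l; first exact: powR_ge0.
  rewrite lerD2l; apply: le_trans (powR_le_id _) _; last exact: ltW (kA a aA).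
  rewrite normr_ge0 (le_trans (ltW (kA a aA)))// invf_le1// lerDl//.
rewrite esumZl ?powR_ge0//; last first.
  by move=> a; rewrite adde_ge0// r0.
rewrite EFinM; apply: lee_wpmul2l; first by rewrite lee_fin powR_ge0.
rewrite esumD//.
rewrite EFinD; apply: leeD.
  by apply: le_trans (phi_e k); exact: esum_subset.
under eq_esum do rewrite EFinM.
rewrite esumZl ?invr_ge0 ?(ltW c1)// cE -EFinM lee_fin mulrC ler_pdivrMr//.
by rewrite mul1r lerDr.
Qed.

(** The depth [n] is chosen so that the tails, whose energies are bounded by [E],
    contribute at most [d / 2]; the finitely many edges of depth less than [n]
    then contribute at most [d / 2] for [U]-almost all [k]. *)
Lemma abs_hardy_cvg0 :
  (forall K : R, (0 < K)%R -> exists n, carleson_from p pi mu n K) ->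
  forall d : R, (0 < d)%R ->
    U [set k | \int[mu]_x (abs_hardy (fun a => phi k a - psi a)%R x `^ p) <= d%:E].
Proof.
move=> carleson d d0; have [k0 _] := filter_ex (@filterT _ U _).
have e0 : (0 <= e)%R by rewrite -lee_fin; apply: le_trans (phi_e k0); exact: energy_ge0.
pose E : R := (2 `^ p * (e + 2 `^ p * (e + 1)))%R.
have E0 : (0 <= E)%R by rewrite /E !(mulr_ge0, addr_ge0, powR_ge0)//.
have kE k : energy (fun a => phi k a - psi a)%R <= E%:E.
  apply: le_trans (energyD_le p_gt1 pi_gt0 _ _) _; rewrite EFinM EFinD.
  apply: lee_wpmul2l; first by rewrite lee_fin powR_ge0.
  by apply: leeD => //; exact: energy_limit_le.
have tp : (0 < 2 `^ p :> R)%R by exact: powR_gt0.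
have t0 : (0 < d / 2 / (2 `^ p * (E + 1)))%R.
  by rewrite !divr_gt0// mulr_gt0// ltr_wpDl.
have [K K0 hK] := hardy_const_small p_gt1 t0.
have [n Hn] := carleson K K0.
pose m : R := fine (mu setT).
have mE : mu setT = m%:E by rewrite fineK// fin_num_measure.
have m0 : (0 <= m)%R by exact: fine_ge0.
set A := [set a : edge T | (edge_depth a < n)%N].
pose c : R := fine (\esum_(a in A) 1%:E).
have cE : \esum_(a in A) 1%:E = c%:E.
  by rewrite fineK//; apply: esum_EFin_fin_num => //; exact: finite_depth.
have c0 : (0 <= c)%R by rewrite -lee_fin -cE esum_ge0.
pose s : R := (Num.min 1 (d / 2 / (2 `^ p * (m + 1))))%R.
have s0 : (0 < s)%R by rewrite lt_min ltr01 !divr_gt0// mulr_gt0// ltr_wpDl.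
have sc0 : (0 < s / (c + 1))%R by rewrite divr_gt0// ltr_wpDl.
apply: filterS (near_head n sc0) => k kA.
apply: le_trans (abs_hardy_inequality p_gt1 pi_gt0 _ K0 Hn) _.
rewrite -/A mE hK.
have head : (\esum_(a in A) (`|phi k a - psi a|%R)%:E) `^ p <= s%:E.
  apply: (@le_trans _ _ (s%:E `^ p)).
    apply: (poweR_le p_gt1); first exact: esum_ge0.
    apply: (@le_trans _ _ (\esum_(a in A) ((s / (c + 1))%:E * 1%:E))).
      by apply: le_esum => a aA; rewrite mule1 lee_fin ltW// kA.
    rewrite esumZl ?divr_ge0 ?addr_ge0 ?(ltW s0)// cE -EFinM lee_fin.
    by rewrite mulrAC ler_pdivrMr ?ltr_wpDl// ler_wpM2l ?(ltW s0)// lerDl.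
  by rewrite poweR_EFin lee_fin powR_le_id// (ltW s0)/= ge_min lexx.
apply: (@le_trans _ _ ((2 `^ p)%:E * (s%:E * m%:E +
    (d / 2 / (2 `^ p * (E + 1)))%:E * E%:E))).
  apply: lee_wpmul2l; first by rewrite lee_fin powR_ge0.
  apply: leeD; first exact: lee_wpmul2r.
  apply: lee_wpmul2l => //.
  by rewrite lee_fin !divr_ge0// ?mulr_ge0 ?addr_ge0// ltW.
rewrite -!EFinM lee_fin.
have h1 : (2 `^ p * (s * m) <= d / 2)%R.
  apply: (@le_trans _ _ (2 `^ p * (d / 2 / (2 `^ p * (m + 1)) * m))%R).
    by rewrite ler_wpM2l ?ler_wpM2r ?(ltW tp)// ge_min lexx orbT.
  rewrite (_ : _ * _ = d / 2 * (m / (m + 1)))%R; last first.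
    by field; rewrite !gt_eqF// ltr_wpDl.
  by rewrite ler_piMr ?divr_ge0 ?(ltW d0)// ler_pdivrMr ?ltr_wpDl// mul1r lerDl.
have h2 : (2 `^ p * (d / 2 / (2 `^ p * (E + 1)) * E) <= d / 2)%R.
  rewrite (_ : _ * _ = d / 2 * (E / (E + 1)))%R; last first.
    by field; rewrite !gt_eqF// ltr_wpDl.
  by rewrite ler_piMr ?divr_ge0 ?(ltW d0)// ler_pdivrMr ?ltr_wpDl// mul1r lerDl.
lra.
Qed.

End PointwiseLimit.
Theorem hardy_compact_of_limit :
  sup_mass_ratio p pi mu n @[n --> \oo] --> 0 -> hardy_compact p pi mu.
Proof.
move=> lim0; have carleson := carleson_from_limit lim0.
have [n1 Hn1] := carleson 1%R ltr01.
have wd := hardy_well_defined_of_carleson p_gt1 pi_gt0 ltr01 Hn1.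
split => //; first exact: (hardy_bounded_of_carleson p_gt1 pi_gt0 ltr01 Hn1).
move=> phi philp [M phiM].
pose e : R := (M `^ p)%R.
have phi_e k : energy (phi k) <= e%:E.
  rewrite -(poweRVK p_gt1 (energy_ge0 p pi_gt0 (phi k))).
  by rewrite /e -poweR_EFin; apply: (poweR_le p_gt1); [exact: poweR_ge0|exact: phiM].
have [U [UU ooU]] := @ultraFilterLemma _ \oo%classic _.
have /choice[psi phi_psi] : forall a, exists l, forall d : R, (0 < d)%R ->
    U [set k | (`|phi k a - l| < d)%R].
  move=> a; apply: (ultra_bounded_cvg (B := (e `^ p^-1 * pi a `^ (- p^-1))%R)) => k.
  exact: normr_le_energy.
have psilp : in_lpi p pi psi.
  by rewrite /in_lpi; apply: le_lt_trans (energy_limit_le phi_e phi_psi) _; rewrite ltry.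
have cvg0 := abs_hardy_cvg0 phi_e phi_psi carleson.
pose u k := \int[mu]_x (abs_hardy (fun a => phi k a - psi a)%R x `^ p).
have /choice[f Hf] : forall jm : nat * nat, exists k, (jm.2 <= k)%N /\
    u k <= ((jm.1.+1%:R^-1 : R) `^ p)%:E.
  move=> [j m] /=; have dj : (0 < (j.+1%:R^-1 : R) `^ p)%R.
    by rewrite powR_gt0// invr_gt0.
  have Um : U [set k | (m <= k)%N] by apply: ooU; exists m.
  by have [k [mk uk]] := filter_ex (filterI Um (cvg0 UU _ dj)); exists k.
(* [s j] is chosen beyond [s j.-1], with error at most [(1 / (j + 1)) ^ p]. *)
pose s := fix s j := if j is j'.+1 then f (j, (s j').+1) else f (0%N, 0%N).
have us j : u (s j) <= ((j.+1%:R^-1 : R) `^ p)%:E.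
  by case: j => [|j]; [have [] := Hf (0%N, 0%N)|have [] := Hf (j.+1, (s j).+1)].
exists s; split.
  by apply/increasing_seqP => j; rewrite ltEnat /=; have [] := Hf (j.+1, (s j).+1).
have [psi_ae psiL] := wd _ psilp.
exists (hardy psi) => //; apply/cvge0P => [j|d d0]; first exact: Lnorm_ge0.
have [N] := ltr_add_invr d0; rewrite add0r => Nd; exists N => j Nj.
have le_u : 'N[mu]_p%:E [EFin \o (hardy (phi (s j)) \- hardy psi)%R] <=
    u (s j) `^ p^-1.
  apply: (Lnorm_le_abs_hardy p_gt1).
    by apply: measurable_funB; exact: measurable_hardy.
  have [phi_ae _] := wd _ (philp (s j)).
  apply: (@filterS2 _ _ (ae_filter_ringOfSetsType mu) _ _ _ _ phi_ae psi_ae) =>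
    x sphi spsi.
  by rewrite /= -hardyB//; exact: normr_hardy_le.
apply: le_trans le_u _; apply: (@le_trans _ _ (((j.+1%:R^-1 : R) `^ p)%:E `^ p^-1)).
  by apply: (poweRV_le p_gt1) => //; apply: integral_ge0 => x _; exact: poweR_ge0.
rewrite -poweR_EFin (poweRK p_gt1) ?lee_fin ?invr_ge0//.
apply: le_trans (ltW Nd); rewrite lef_pV2 ?posrE// ler_nat; exact: Nj.
Qed.

End Compactness.
(** * The limit condition from compactness *)

Section Necessity.
Context (R : realType) (T : rooted_tree) (p : R) (p_gt1 : 1 < p).
Context (pi : edge T -> R) (pi_gt0 : forall a, 0 < pi a).
Context (mu : {finite_measure set (borel_tbar T) -> \bar R}).
Implicit Types (phi psi : edge T -> R) (a b : edge T) (B : set (edge T)).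
Local Open Scope ereal_scope.
Local Notation energy phi := (\esum_(a in [set: edge T]) (`|phi a| `^ p * pi a)%:E).
Local Notation term := (carleson_weight p pi mu).
Local Notation m := (branch_mass mu).

Let q := (p / (p - 1))%R.
Let p_gt0 : (0 < p)%R. Proof. exact: lt_trans p_gt1. Qed.
Let p1_gt0 : (0 < p - 1)%R. Proof. by rewrite subr_gt0. Qed.
Let q_gt1 : (1 < q)%R. Proof. by rewrite ltr_pdivlMr// mul1r ltrBlDr ltrDl. Qed.
Let q_gt0 : (0 < q)%R. Proof. exact: lt_trans q_gt1. Qed.
Let pq : (p^-1 + q^-1 = 1)%R. Proof. by rewrite /q; field; rewrite !gt_eqF. Qed.

Lemma ae_le_Lnorm (f g : borel_tbar T -> R) :
  measurable_fun [set: borel_tbar T] f -> measurable_fun [set: borel_tbar T] g ->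
  {ae mu, forall x, (`|f x| <= `|g x|)%R} ->
  'N[mu]_p%:E [EFin \o f] <= 'N[mu]_p%:E [EFin \o g].
Proof.
move=> mf mg fg; rewrite unlock; apply: (poweRV_le p_gt1).
  by apply: integral_ge0 => x _; exact: poweR_ge0.
have mpow (h : borel_tbar T -> R) : measurable_fun [set: borel_tbar T] h ->
    measurable_fun [set: borel_tbar T]
      ((fun x => `|(EFin \o h) x| `^ p) : borel_tbar T -> \bar R).
  move=> mh; apply: (measurableT_comp (measurable_poweR p)).
  by apply: measurableT_comp => //; exact/measurable_EFinP.
apply: ae_ge0_le_integral => //.
- by move=> x _; exact: poweR_ge0.
- exact: mpow.
- by move=> x _; exact: poweR_ge0.
- exact: mpow.
- apply: filterS fg => x fgx _; exact: (poweR_le p_gt1).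
Qed.

Lemma Lnorm_indic (A : set (borel_tbar T)) : measurable A ->
  'N[mu]_q%:E [EFin \o \1_A] = mu A `^ q^-1.
Proof.
move=> mA; rewrite unlock; congr (_ `^ _).
rewrite -[RHS]/(mu A) -[in RHS](setIT A) -integral_indic//.
apply: eq_integral => x _ /=; rewrite indicE ger0_norm//.
by case: (x \in A); rewrite ?powR1// powR0// gt_eqF.
Qed.

Lemma int_le_Lnorm (f : borel_tbar T -> R) (A : set (borel_tbar T)) :
  measurable_fun [set: borel_tbar T] f -> measurable A ->
  \int[mu]_x (`|f x * \1_A x|)%:E <= 'N[mu]_p%:E [EFin \o f] * mu A `^ q^-1.
Proof.
move=> mf mA; rewrite -Lnorm_indic//.
apply: le_trans (hoelder mu mf (measurable_indic mA) p_gt0 q_gt0 pq).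
by rewrite Lnorm1.
Qed.

(** The extremal function of Hoelder's inequality for the pairing of [phi] with
    [mu (S_ _)] over [B]; the factor [N ^ - p^-1] gives it norm [1]. *)
Definition test_function B (N : R) b : R :=
  (if b \in B then N `^ (- p^-1) * (pi b `^ (1 - q) * m b `^ (q - 1)) else 0)%R.

Section TestFunction.
Context (B : set (edge T)) (N : R) (N_gt0 : (0 < N)%R).
Context (BN : \esum_(b in B) term b = N%:E).
Local Notation phi := (test_function B N).

Lemma test_function_ge0 b : (0 <= phi b)%R.
Proof. by rewrite /test_function; case: ifP => // _; rewrite !mulr_ge0 ?powR_ge0. Qed.

Lemma energy_test_function : energy phi = 1.
Proof.
have -> : energy phi = \esum_(b in [set: edge T])
    if b \in B then (N^-1)%:E * term b else 0.
  apply: eq_esum => b _; rewrite ger0_norm ?test_function_ge0// /test_function.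
  case: ifP => _; last by rewrite powR0 ?mul0r// gt_eqF.
  rewrite carleson_weightE -/q -EFinM; congr EFin.
  rewrite !powRM ?mulr_ge0 ?powR_ge0// -!powRrM.
  have -> : ((q - 1) * p = q)%R by rewrite /q; field; rewrite gt_eqF.
  have -> : (- p^-1 * p = -1)%R by rewrite mulNr mulVf// gt_eqF.
  rewrite (powR_inv1 (ltW N_gt0)) -!mulrA; congr (_ * _)%R.
  rewrite [(m b `^ q * _)%R]mulrC mulrA; congr (_ * _)%R.
  rewrite -{2}(powRr1 (ltW (pi_gt0 b))) -powRD; last by rewrite (gt_eqF (pi_gt0 b)) implybT.
  by congr (_ `^ _)%R; rewrite /q; field; rewrite gt_eqF.
rewrite -esum_mkcond esumZl ?invr_ge0 ?(ltW N_gt0)//; last exact: carleson_weight_ge0.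
by rewrite BN -EFinM mulVf// gt_eqF.
Qed.

Lemma in_lpi_test_function : in_lpi p pi phi.
Proof. by rewrite /in_lpi energy_test_function ltry. Qed.

Lemma lpi_norm_test_function : lpi_norm p pi phi = 1.
Proof. by rewrite /lpi_norm energy_test_function poweR1r. Qed.

Lemma integral_abs_hardy_test : \int[mu]_x (abs_hardy phi x) = (N `^ q^-1)%:E.
Proof.
rewrite /abs_hardy integral_esum_edges_to; last by move=> b; rewrite lee_fin.
have -> : \esum_(a in [set: edge T]) ((`|phi a|)%:E * mu (S_ a)) =
    \esum_(b in [set: edge T]) if b \in B then (N `^ (- p^-1))%:E * term b else 0.
  apply: eq_esum => b _; rewrite ger0_norm ?test_function_ge0// /test_function.
  rewrite branch_massE; case: ifP => _; last by rewrite mul0e.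
  rewrite carleson_weightE -/q -!EFinM; congr EFin.
  by rewrite -(mulr_powRB1 (branch_mass_ge0 mu b) q_gt0); ring.
rewrite -esum_mkcond esumZl ?powR_ge0//; last exact: carleson_weight_ge0.
rewrite BN -EFinM -{2}(powRr1 (ltW N_gt0)) -powRD; last by rewrite (gt_eqF N_gt0) implybT.
by congr (_ `^ _)%:E; rewrite -pq; ring.
Qed.

(** Hoelder's inequality with the indicator of [A], outside of which the image of
    the test function vanishes. *)
Lemma test_function_bound (A : set (borel_tbar T)) : hardy_well_defined p pi mu ->
  measurable A -> (forall b, B b -> S_ b `<=` A) ->
  (N `^ q^-1)%:E <= 'N[mu]_p%:E [EFin \o hardy phi] * mu A `^ q^-1.
Proof.
move=> wd mA BA; have [phi_ae _] := wd _ in_lpi_test_function.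
have mh : measurable_fun [set: borel_tbar T] (hardy phi : borel_tbar T -> R).
  exact: measurable_hardy.
rewrite -integral_abs_hardy_test; apply: le_trans (int_le_Lnorm mh mA).
apply: ae_ge0_le_integral => //.
- by move=> x _; exact: abs_hardy_ge0.
- exact: measurable_abs_hardy.
- apply/measurable_EFinP; apply: measurableT_comp => //.
  by apply: measurable_funM => //; exact: measurable_indic.
apply: (@filterS _ _ (ae_filter_ringOfSetsType mu) _ _ _ phi_ae) => x sphi _; rewrite indicE.
have abs_hardyE : abs_hardy phi x = (hardy phi x)%:E.
  rewrite (ge0_hardyE test_function_ge0 sphi).
  by apply: eq_esum => b _; rewrite ger0_norm// test_function_ge0.
have [xA|xA] := boolP (x \in A); first by rewrite mulr1 abs_hardyE lee_fin ler_norm.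
rewrite mulr0 normr0 /abs_hardy esum1// => b xb.
rewrite /test_function; case: ifP => [|_]; last by rewrite normr0.
by rewrite inE => /BA/(_ x xb); move: xA; rewrite notin_setE.
Qed.

End TestFunction.

Section Bounded.
Context (wd : hardy_well_defined p pi mu) (C : R).
Context (hC : forall phi, in_lpi p pi phi ->
    'N[mu]_p%:E [EFin \o hardy phi] <= C%:E * lpi_norm p pi phi).

(** [N ^ q^-1 <= C * mu A ^ q^-1] for the finite parts of [B], by
    [test_function_bound]. *)
Lemma carleson_sum_le B (A : set (borel_tbar T)) : measurable A ->
  (forall b, B b -> S_ b `<=` A) ->
  \esum_(b in B) term b <= (C `^ q)%:E * mu A.
Proof.
move=> mA BA; have t0 := carleson_weight_ge0 p pi mu.
apply: (esum_le_bounded (d := @edge_depth T)) => // n.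
set D := B `&` _; pose N : R := fine (\esum_(b in D) term b).
have DN : \esum_(b in D) term b = N%:E.
  rewrite fineK//; under eq_esum do rewrite carleson_weightE.
  apply: esum_EFin_fin_num => [|b]; last by rewrite mulr_ge0 ?powR_ge0.
  apply: (@sub_finite_set _ _ [set b : edge T | (edge_depth b < n)%N]).
    by move=> b [].
  exact: finite_depth.
rewrite DN; have := esum_ge0 (fun b (_ : D b) => t0 b); rewrite DN lee_fin.
rewrite le_eqVlt => /orP[/eqP<-|N0]; first by rewrite mule_ge0// lee_fin powR_ge0.
have DA b : D b -> S_ b `<=` A by case=> /BA.
have phi_lp := in_lpi_test_function N0 DN.
have := test_function_bound N0 DN wd mA DA; have := hC phi_lp.
rewrite (lpi_norm_test_function N0 DN) mule1 => NC NA.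
have C0 : (0 <= C)%R by rewrite -lee_fin (le_trans _ NC)// Lnorm_ge0.
have {NC}NA : (N `^ q^-1)%:E <= C%:E * mu A `^ q^-1.
  by apply: le_trans NA _; apply: lee_wpmul2r => //; exact: poweR_ge0.
have := poweR_le q_gt1 _ NA; rewrite lee_fin powR_ge0 => /(_ isT).
rewrite -poweR_EFin (poweRVK q_gt1) ?lee_fin ?(ltW N0)//.
by rewrite poweRM ?lee_fin ?poweR_ge0// (poweRVK q_gt1)// poweR_EFin.
Qed.

Lemma carleson_sum_tail (e : R) : (0 < e)%R -> exists n, forall a, (n <= edge_depth a)%N ->
  \esum_(b in [set b | edge_sub b a]) term b <= e%:E.
Proof.
move=> e0; have t0 := carleson_weight_ge0 p pi mu.
have fin : \esum_(b in [set: edge T]) term b < +oo.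
  apply: le_lt_trans (@carleson_sum_le setT setT measurableT _) _ => //.
  have mT : mu setT \is a fin_num by exact: fin_num_measure.
  by rewrite -(fineK mT) -EFinM ltry.
have [n Hn] := esum_tail (@edge_depth T) t0 fin e0.
exists n => a na; apply: le_trans Hn; apply: esum_subset => b /= ba; split=> //=.
exact: leq_trans na (edge_sub_depth ba).
Qed.

End Bounded.
Theorem limit_of_hardy_compact : hardy_compact p pi mu ->
  sup_mass_ratio p pi mu n @[n --> \oo] --> 0.
Proof.
move=> [wd [C hC] cpt]; apply: contrapT => not_lim.
have t0 := carleson_weight_ge0 p pi mu.
have [d d0 Hd] : exists2 d : R, (0 < d)%R &
    forall n, exists a, (n <= edge_depth a)%N /\ d%:E < mass_ratio p pi mu a.
  apply: contrapT => H; apply: not_lim.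
  apply/(cvge0P (sup_mass_ratio_ge0 p pi mu)) => d d0.
  apply: contrapT => Hn; apply: H; exists d => // n.
  apply: contrapT => Ha; apply: Hn; exists n => k nk.
  apply: ge_ereal_sup => _ [->|[a /= ka <-]]; first by rewrite lee_fin ltW.
  rewrite leNgt; apply/negP => da; apply: Ha; exists a; split=> //.
  exact: leq_trans nk ka.
have {Hd}/choice[a Ha] := Hd.
pose B n := [set b | edge_sub b (a n)].
pose N n : R := fine (\esum_(b in B n) term b).
have BS n b : B n b -> S_ b `<=` (S_ (a n) : set (borel_tbar T)).
  by move=> ba x xb; have [xa _] := iffLR (edge_sub_edges_to (a n) xb) ba.
have S_m n : measurable (S_ (a n) : set (borel_tbar T)) by exact: measurable_S.
have N_le n : \esum_(b in B n) term b <= (C `^ q)%:E * (m (a n))%:E.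
  by rewrite -branch_massE; exact: (carleson_sum_le wd hC (S_m n) (@BS n)).
have BN n : \esum_(b in B n) term b = (N n)%:E.
  rewrite fineK// ge0_fin_numE ?esum_ge0// (le_lt_trans (N_le n))//.
  by rewrite -EFinM ltry.
have dN n : (d * m (a n) < N n)%R.
  have [_] := Ha n; rewrite !ltNge; apply: contra => le_N.
  apply/(mass_ratio_leE p pi mu (a n) (ltW d0)).
  by rewrite branch_massE -EFinM -/(B n) BN lee_fin.
have m_ge0 n : (0 <= m (a n))%R by exact: branch_mass_ge0.
have N0 n : (0 < N n)%R by apply: le_lt_trans (dN n); rewrite mulr_ge0// ltW.
have m0 n : (0 < m (a n))%R.
  rewrite lt_neqAle m_ge0 andbT; apply/eqP => m0.
  by move: (N_le n); rewrite BN -m0 mule0 lee_fin leNgt N0.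
pose phi n := test_function (B n) (N n).
have phi_lp n : in_lpi p pi (phi n) by exact: in_lpi_test_function.
have phi1 n : lpi_norm p pi (phi n) = 1 by exact: lpi_norm_test_function.
pose f n : borel_tbar T -> R := hardy (phi n).
have mf n : measurable_fun [set: borel_tbar T] (f n) by exact: measurable_hardy.
have f_ge n : (d `^ q^-1)%:E <= 'N[mu]_p%:E [EFin \o f n].
  have := test_function_bound (N0 n) (BN n) wd (S_m n) (BS n).
  rewrite branch_massE poweR_EFin -lee_pdivrMr ?powR_gt0//; apply: le_trans.
  rewrite -EFinM lee_fin ler_pdivlMr ?powR_gt0// -powRM ?(ltW d0)//.
  by rewrite ge0_ler_powR ?nnegrE ?mulr_ge0 ?invr_ge0 ?ltW.
have [|s [s_inc [g gL cvg_g]]] := cpt phi phi_lp.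
  by exists 1%R => n; rewrite phi1.
have mg : measurable_fun [set: borel_tbar T] g.
  by move: gL; rewrite inE => /andP[]; rewrite inE.
have mfg n : measurable_fun [set: borel_tbar T] (f n \- g)%R by exact: measurable_funB.
have {}cvg_g := iffLR (cvge0P (fun j => Lnorm_ge0 _ _ _)) cvg_g.
have s_ge j : (j <= s j)%N.
  elim: j => // j IH; apply: leq_ltn_trans IH _.
  by move/increasing_seqP: s_inc => /(_ j); rewrite ltEnat.
have mT : mu setT \is a fin_num by exact: fin_num_measure.
pose M : R := fine (mu setT `^ q^-1).
have ME : mu setT `^ q^-1 = M%:E by rewrite fineK// fin_num_poweR.
have M0 : (0 <= M)%R by rewrite -lee_fin -ME poweR_ge0.
have int_le (h : borel_tbar T -> R) : measurable_fun [set: borel_tbar T] h ->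
    'N[mu]_1 [EFin \o h] <= 'N[mu]_p%:E [EFin \o h] * M%:E.
  move=> mh; rewrite -ME Lnorm1; apply: le_trans (int_le_Lnorm mh measurableT).
  rewrite le_eqVlt; apply/orP; left; apply/eqP; apply: eq_integral => x _.
  by rewrite indicT mulr1.
have f1 n : 'N[mu]_1 [EFin \o f n] <= (N n `^ q^-1)%:E.
  rewrite Lnorm1 -(integral_abs_hardy_test (N0 n) (BN n)); apply: ge0_le_integral => //.
  - by apply: measurableT_comp => //; exact/measurable_EFinP.
  - exact: measurable_abs_hardy.
  - by move=> x _; exact: normr_hardy_le.
(* The images tend to [g] in [L^p], hence in [L^1] since [mu] is finite; there
   they tend to [0], by the vanishing of the tails. *)
have g1 : 'N[mu]_1 [EFin \o g] = 0.
  apply/eqP; rewrite eq_le Lnorm_ge0 andbT; apply/lee_addgt0Pr => e e0; rewrite add0e.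
  have e2 : (0 < e / 2)%R by rewrite divr_gt0.
  have eM : (0 < e / 2 / (M + 1))%R by rewrite divr_gt0// ltr_wpDl.
  have eq0 : (0 < (e / 2) `^ q)%R by exact: powR_gt0.
  have [J HJ] := cvg_g _ eM; have [n Hn] := carleson_sum_tail wd hC eq0.
  pose k := s (maxn J n).
  have nk : (n <= edge_depth (a k))%N.
    have [ka _] := Ha k; apply: leq_trans ka; apply: leq_trans (s_ge _).
    exact: leq_maxr.
  have fk : 'N[mu]_1 [EFin \o f k] <= (e / 2)%:E.
    apply: le_trans (f1 k) _; move: (Hn _ nk); rewrite -/(B k) BN => Nk.
    have := poweRV_le q_gt1 _ Nk; rewrite lee_fin ltW// => /(_ isT).
    by rewrite !poweR_EFin -powRrM mulfV ?gt_eqF// powRr1// ltW.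
  have gk : 'N[mu]_1 [EFin \o (g \- f k)%R] <= (e / 2)%:E.
    have -> : 'N[mu]_1 [EFin \o (g \- f k)%R] = 'N[mu]_1 [EFin \o (f k \- g)%R].
      rewrite !Lnorm1; apply: eq_integral => x _ /=.
      by rewrite distrC.
    apply: le_trans (int_le _ (mfg k)) _.
    apply: (@le_trans _ _ ((e / 2 / (M + 1))%:E * M%:E)).
      by apply: lee_wpmul2r; [rewrite lee_fin|apply: HJ; exact: leq_maxl].
    rewrite -EFinM lee_fin mulrAC ler_pdivrMr ?ltr_wpDl//.
    by rewrite ler_wpM2l ?ltW// ltrDl.
  have -> : EFin \o g = EFin \o (f k \+ (g \- f k))%R.
    by apply/funext => x /=; rewrite addrC subrK.
  apply: le_trans (minkowski_EFin mu (mf k) _ (lexx _)) _.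
    exact: measurable_funB.
  by rewrite [e]splitr EFinD; apply: leeD.
have g0 : {ae mu, forall x, g x = 0%R}.
  have : measurable_fun [set: borel_tbar T] (EFin \o g) by exact/measurable_EFinP.
  move=> /Lnorm_eq0_eq0/(_ lte01 g1); apply: filterS => x /(_ I) /=.
  by case.
have dq0 : (0 < d `^ q^-1)%R by exact: powR_gt0.
have [|J HJ] := cvg_g (d `^ q^-1 / 2)%R; first by rewrite divr_gt0.
have fg : 'N[mu]_p%:E [EFin \o f (s J)] <= 'N[mu]_p%:E [EFin \o (f (s J) \- g)%R].
  apply: ae_le_Lnorm => //.
  apply: (@filterS _ _ (ae_filter_ringOfSetsType mu) _ _ _ g0) => x gx.
  by rewrite /= gx subr0.
have := le_trans (f_ge _) (le_trans fg (HJ J (leqnn J))).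
by rewrite lee_fin leNgt ltr_pdivrMr// ltr_pMr// ltr1n.
Qed.

End Necessity.

Theorem theorem23 (R : realType) (T : rooted_tree) (p : R) (p_gt1 : 1 < p)
    (pi : edge T -> R) (pi_gt0 : forall a, 0 < pi a)
    (mu : {finite_measure set (borel_tbar T) -> \bar R}) :
  hardy_compact p pi mu <->
  sup_mass_ratio p pi mu n @[n --> \oo] --> 0%E.
Proof.
split; first exact: limit_of_hardy_compact.
exact: hardy_compact_of_limit.
Qed.
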